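(* Let $K$ be a perfect field, $V_1,\dots,V_d$ finite-dimensional $K$-vector spaces with fixed bases, $V=V_1\otimes\cdots\otimes V_d$ and $G=\mathrm{GL}(V_1)\times\cdots\times\mathrm{GL}(V_d)$. For any weight $\alpha\in\mathbb{R}^d_{>0}$ and any $r\in\mathbb{R}$, each of the sets $$X^\circ(\operatorname{rk}^G_\alpha,r)=\{v\in V\mid \operatorname{rk}^G_\alpha(v)<r\}\quad\text{and}\quad X(\operatorname{rk}^G_\alpha,r)=\{v\in V\mid \operatorname{rk}^G_\alpha(v)\le r\}$$ is a finite union of sets of the form $G\cdot Z=\bigcup_{g\in G}g\cdot Z$, where $Z\subseteq V$ is a Borel-fixed subspace. In particular, these sets are Zariski closed in $V$.
   Context: Using the fixed bases, identify $\mathrm{GL}(V_i)$ with $\mathrm{GL}_{n_i}$, $n_i=\dim V_i$. Let $B=B_{n_1}\times\cdots\times B_{n_d}\subseteq G$ where $B_k\subseteq\mathrm{GL}_k$ is the group of invertible upper triangular matrices. A subspace $Z\subseteq V$ is Borel-fixed if it is stable under the action of $B$. The empty union is allowed. $G$-stable rank: for a $K$-vector space $W$ and $v(t)\in K((t))\otimes W$, $\operatorname{val}_t(v(t))$ is the largest integer $m$ with $v(t)\in t^m(K[[t]]\otimes W)$, and $\operatorname{val}_t(0)=\infty$. Let $\mathrm{GL}(V_i,K[[t]])$ be the set of elements of $K[[t]]\otimes\operatorname{End}(V_i)$ that are invertible over $K((t))$ (the inverse need not have entries in $K[[t]]$), and $G(K[[t]])=\prod_i\mathrm{GL}(V_i,K[[t]])$,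 acting on $K((t))\otimes V$ factorwise. Then $\operatorname{rk}^G_\alpha(v)$ is the infimum of $$\mu_\alpha(g(t),v)=\frac{\sum_{i=1}^d\alpha_i\operatorname{val}_t(\det g_i(t))}{\operatorname{val}_t(g(t)\cdot v)}$$ over all $g(t)=(g_1(t),\dots,g_d(t))\in G(K[[t]])$ with $\operatorname{val}_t(g(t)\cdot v)>0$ (a quotient with denominator $\infty$ is $0$). *)

(* Defs.v *)
From HB Require Import structures.
From mathcomp Require Import all_boot all_order all_algebra all_field.
From mathcomp Require Import all_classical all_reals ereal.
(* The notations of mpoly clash with those of mathcomp-analysis. *)
From mathcomp Require Import -(notations) mpoly.

Set Implicit Arguments.
Unset Strict Implicit.
Unset Printing Implicit Defensive.
Import Order.TTheory GRing.Theory Num.Theory.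
Local Open Scope classical_set_scope.
Local Open Scope ring_scope.

Definition perfect_field (K : fieldType) : Prop :=
  forall p : {poly K}, irreducible_poly p -> separable_poly p.

(* K[[t]]: [p k] is the coefficient of t^k, and the product is the Cauchy
   product.  The alias hides the pointwise product that mathcomp-analysis puts
   on [nat -> K]. *)
Definition powerseries (K : fieldType) : Type := nat -> K.

HB.instance Definition _ (K : fieldType) :=
  GRing.Zmodule.copy (powerseries K) (nat -> K).

Section PowerSeriesRing.
Variable K : fieldType.
Implicit Types p q r : powerseries K.

Definition ps_const (c : K) : powerseries K :=
  fun k => if k == 0%N then c else 0.

Definition ps_t : powerseries K := fun k => (k == 1%N)%:R.

Definition ps_mul p q : powerseries K :=
  fun k => \sum_(j < k.+1) p j * q (k - j)%N.

Let trunc (N : nat) p : {poly K} := \poly_(i < N) p i.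

Let ps_mulE N k p q : (k < N)%N -> ps_mul p q k = (trunc N p * trunc N q)`_k.
Proof.
move=> kN; rewrite coefM /ps_mul; apply: eq_bigr => j _; rewrite !coef_poly.
by rewrite (leq_ltn_trans (leq_subr _ _) kN) (leq_trans (ltn_ord j) kN).
Qed.

Let ps_mulC : commutative ps_mul.
Proof.
move=> p q; apply/funext => k.
by rewrite !(@ps_mulE k.+1) // mulrC.
Qed.

Let ps_mulA : associative ps_mul.
Proof.
move=> p q r; apply/funext => k.
have h N (a b c : powerseries K) j : (j < N)%N ->
    (trunc N (ps_mul a b) * trunc N c)`_j =
    (trunc N a * trunc N b * trunc N c)`_j.
  move=> jN; rewrite !(coefM _ (trunc N c)); apply: eq_bigr => i _; congr (_ * _).
  have iN : (i < N)%N by exact: leq_trans (ltn_ord i) jN.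
  by rewrite coef_poly iN (@ps_mulE N).
rewrite ps_mulC !(@ps_mulE k.+1) // !h //.
by rewrite mulrC mulrA.
Qed.

Let ps_mul1 : left_id (ps_const 1) ps_mul.
Proof.
move=> p; apply/funext => k; rewrite /ps_mul big_ord_recl /= /ps_const /= mul1r.
by rewrite subn0 big1 ?addr0 // => i _; rewrite mul0r.
Qed.

Let ps_mulDl : left_distributive ps_mul +%R.
Proof.
move=> p q r; apply/funext => k; rewrite /ps_mul.
change (\sum_(j < k.+1) (p j + q j) * r (k - j)%N =
  \sum_(j < k.+1) p j * r (k - j)%N + \sum_(j < k.+1) q j * r (k - j)%N).
by rewrite -big_split; apply: eq_bigr => j _; rewrite mulrDl.
Qed.

Let ps_1_neq0 : ps_const 1 != 0.
Proof.
by apply/eqP => /(congr1 (fun f => f 0%N)); apply/eqP; rewrite oner_eq0.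
Qed.

HB.instance Definition _ := GRing.Zmodule_isComNzRing.Build (powerseries K)
  ps_mulA ps_mulC ps_mul1 ps_mulDl ps_1_neq0.

Definition ps_unit : {pred powerseries K} := [pred p | `[< exists q, q * p = 1 >]].

Definition ps_inv p : powerseries K :=
  if pselect (exists q, q * p = 1) is left h then projT1 (cid h) else p.

Let ps_mulVx : {in ps_unit, left_inverse 1 ps_inv *%R}.
Proof.
move=> p /asboolP hp; rewrite /ps_inv; case: pselect => // h.
by case: cid.
Qed.

Let ps_unitPl p q : q * p = 1 -> ps_unit p.
Proof. by move=> qp; apply/asboolP; exists q. Qed.

Let ps_invr_out : {in [predC ps_unit], ps_inv =1 id}.
Proof.
move=> p; rewrite !inE => /asboolPn hp.
by rewrite /ps_inv; case: pselect => // /hp.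
Qed.

HB.instance Definition _ := GRing.ComNzRing_hasMulInverse.Build (powerseries K)
  ps_mulVx ps_unitPl ps_invr_out.

Let ps_neq0 p : p != 0 -> {m | p m != 0 & forall j, (j < m)%N -> p j = 0}.
Proof.
move=> p0; have ex : exists m, p m != 0.
  apply/not_existsP => h; move/eqP: p0; apply; apply/funext => m.
  by apply/eqP/negPn/negP; exact: h.
exists (ex_minn ex); first by case: ex_minnP.
case: ex_minnP => m _ mmin j jm; apply/eqP/negPn/negP => /mmin.
by rewrite leqNgt jm.
Qed.

Let ps_idomain : GRing.integral_domain_axiom (powerseries K).
Proof.
move=> p q pq0; apply/negPn/negP; rewrite negb_or => /andP[].
move=> /ps_neq0 [m pm hp] /ps_neq0 [l ql hq].
have : ps_mul p q (m + l)%N = 0 by exact: (congr1 (fun f => f (m + l)%N) pq0).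
have ml : (m < (m + l).+1)%N by rewrite ltnS leq_addr.
rewrite /ps_mul (bigD1 (Ordinal ml)) //= addKn big1 ?addr0.
  by move/eqP; rewrite mulf_eq0 (negPf pm) (negPf ql).
move=> i /eqP im; have [lt|ge] := ltnP i m; first by rewrite hp ?mul0r.
rewrite (hq (m + l - i)%N) ?mulr0 //.
have lt : (m < i)%N.
  by rewrite ltn_neqAle ge andbT; apply/eqP => e; apply: im; apply: val_inj.
by rewrite ltn_subLR ?ltn_add2r // -ltnS.
Qed.

HB.instance Definition _ :=
  GRing.ComUnitRing_isIntegral.Build (powerseries K) ps_idomain.

End PowerSeriesRing.

(* K((t)) *)
Definition laurent (K : fieldType) : fieldType := {fraction powerseries K}.

Definition ps_laurent (K : fieldType) (p : powerseries K) : laurent K :=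
  @FracField.tofrac (powerseries K) p.

(* val_t on K((t)) (x) W, where W = K^I.  The supremum over the integers m with
   w in t^m (K[[t]] (x) W) is their maximum when w != 0, and +oo when w = 0. *)
Definition tval (R : realType) (K : fieldType) (I : finType)
    (w : I -> laurent K) : \bar R :=
  ereal_sup [set (m%:~R)%:E | m in [set m : int |
    exists u : I -> powerseries K,
      forall i, w i = ps_laurent (ps_t K) ^ m * ps_laurent (u i)]].

(* V_i = K^(n i), so that V_1 (x) ... (x) V_d has a basis indexed by the tuples
   (j_i)_i with j_i < n i.  A tensor over A is its family of coordinates. *)
Definition mindex (d : nat) (n : 'I_d -> nat) : finType :=
  {dffun forall i : 'I_d, 'I_(n i)}.

Notation tensor A n := {ffun mindex n -> A^o}.

Definition tensor_act (A : comNzRingType) (d : nat) (n : 'I_d -> nat)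
    (g : forall i : 'I_d, 'M[A]_(n i)) (v : tensor A n) : tensor A n :=
  [ffun j : mindex n =>
    \sum_(k : mindex n) (\prod_(i < d) g i (j i) (k i)) * v k].

Definition pure_tensor (A : comNzRingType) (d : nat) (n : 'I_d -> nat)
    (u : forall i : 'I_d, 'cV[A]_(n i)) : tensor A n :=
  [ffun j : mindex n => \prod_(i < d) u i (j i) 0].

Lemma tensor_act_pure (A : comNzRingType) (d : nat) (n : 'I_d -> nat)
    (g : forall i : 'I_d, 'M[A]_(n i)) (u : forall i : 'I_d, 'cV[A]_(n i)) :
  tensor_act g (pure_tensor u) = pure_tensor (fun i => g i *m u i).
Proof.
apply/ffunP => j; rewrite !ffunE.
pose F i := [ffun l : 'I_(n i) => g i (j i) l * u i l 0].
transitivity (\sum_(k : mindex n) \prod_(i < d) F i (k i)).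
  by apply: eq_bigr => k _; rewrite ffunE -big_split; apply: eq_bigr => i _;
     rewrite ffunE.
rewrite (reindex (@dffun_of_fprod _ _)); last first.
  exact/onW_bij/dffun_of_fprod_bij.
transitivity (\sum_(t : fprod (fun i => 'I_(n i))) \prod_(i < d) F i (t i)).
  apply: eq_bigr => t _; apply: eq_bigr => i _; congr (F i _).
  by rewrite /dffun_of_fprod ffunE.
rewrite big_fprod -(bigA_distr_big_dep _ (fun i => untag 0 (F i))).
apply: eq_bigr => i _; rewrite mxE.
transitivity (\sum_(l : 'I_(n i)) F i l); last first.
  by apply: eq_bigr => l _; rewrite ffunE.
exact/esym/(big_tag (fun i => F i) i).
Qed.

Section StableRank.
Variables (R : realType) (K : fieldType) (d : nat) (n : 'I_d -> nat).

Definition in_G (g : forall i : 'I_d, 'M[K]_(n i)) : Prop :=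
  forall i, g i \in unitmx.

Definition in_B (g : forall i : 'I_d, 'M[K]_(n i)) : Prop :=
  forall i, g i \in unitmx /\ forall k l : 'I_(n i), (l < k)%N -> g i k l = 0.

Definition borel_fixed (Z : {vspace tensor K n}) : Prop :=
  forall b, in_B b -> forall z, z \in Z -> tensor_act b z \in Z.

Definition G_translates (Z : {vspace tensor K n}) : set (tensor K n) :=
  [set v | exists2 g, in_G g & exists2 z, z \in Z & v = tensor_act g z].

Definition finite_union_G_translates (X : set (tensor K n)) : Prop :=
  exists2 s : seq {vspace tensor K n},
    forall Z, Z \in s -> borel_fixed Z &
    X = \bigcup_(Z in [set` s]) G_translates Z.

Definition zariski_closed (X : set (tensor K n)) : Prop :=
  exists S : set (mpoly #|mindex n| K),
    X = [set v : tensor K n | forall p, S p -> meval (fun i => v (enum_val i) : K) p = 0].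

Definition to_laurent (g : forall i : 'I_d, 'M[powerseries K]_(n i)) :
    forall i : 'I_d, 'M[laurent K]_(n i) :=
  fun i => map_mx (@ps_laurent K) (g i).

Definition in_Gt (g : forall i : 'I_d, 'M[powerseries K]_(n i)) : Prop :=
  forall i, to_laurent g i \in unitmx.

Definition gt_act (g : forall i : 'I_d, 'M[powerseries K]_(n i))
    (v : tensor K n) : tensor (laurent K) n :=
  tensor_act (to_laurent g) [ffun j => ps_laurent (@ps_const K (v j)) : (laurent K)^o].

(* In \bar R, x / +oo = 0. *)
Definition stable_mu (alpha : 'I_d -> R)
    (g : forall i : 'I_d, 'M[powerseries K]_(n i)) (v : tensor K n) : \bar R :=
  ((\sum_(i < d) (alpha i)%:E * tval R (fun _ : unit => \det (to_laurent g i)))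
   / tval R (gt_act g v))%E.

Definition stable_rank (alpha : 'I_d -> R) (v : tensor K n) : \bar R :=
  ereal_inf [set stable_mu alpha g v | g in
    [set g | in_Gt g /\ (0 < tval R (gt_act g v))%E]].

End StableRank.

(* Main.v *)
(* Smith normal form over K[[t]], evaluated at t = 0, shows that rk(v) < r iff
   some g in G and some nonnegative weights a satisfy
   sum_i alpha_i sum_l a_{i,l} < r sum_i a_{i,j_i} for every j in the support
   of g v.  With the weights sorted, the indices j satisfying this inequality
   form a set S closed under decreasing coordinates, so that {rk < r} is a
   finite union of sets G Z_S, and {rk <= r} = {rk < r'} for some r' > r.

   Closedness.  Let v lie in the closure of G Z_S.  The generic point of G Z_S
   admits a place centered at v with residue field k algebraic over K, and the
   Iwasawa decomposition over the valuation ring (properness of the flag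
   variety) gives v in G(k) Z_S(k).  Kempf's argument descends this to K: among
   all finite separable extensions, take a weighted flag destabilizing v with
   weights of minimal norm.  Two such flags have a common splitting basis
   (Bruhat), so by strict convexity they coincide; hence the flag is invariant
   under all embeddings, and is defined over the perfect field K. *)

Require Import Defs.
From HB Require Import structures.
From mathcomp Require Import all_boot all_order all_algebra all_field.
From mathcomp Require Import all_fingroup.
From mathcomp Require Import all_classical all_reals ereal.
From mathcomp Require Import topology normedtype derive.
From mathcomp Require Import ring lra.
From mathcomp Require Import -(notations) mpoly.

Set Implicit Arguments.
Unset Strict Implicit.
Unset Printing Implicit Defensive.
Import Order.TTheory GRing.Theory Num.Theory.
Import numFieldNormedType.Exports.
Local Open Scope classical_set_scope.
Local Open Scope ring_scope.

(** * Pattern matrices and matrix decompositions *)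

(** The descent to [K] changes the weight, hence possibly the stratum: a limit point of one [G Z_S]
    is only shown to lie in the union, so closedness is obtained for [{rk < r}] as a whole and not
    for each [G Z_S]. The residue field of the place may be infinite over [K]; only the finitely
    many entries of one matrix are moved into a finite extension. No Galois closure is formed: an
    extension is built by adjoining roots one at a time, and an element of the top field is brought
    down one storey by comparing two embeddings into a further field [W], obtained by adjoining one
    more root. This is why the norm is minimized over all such extensions at once: minimality has to
    hold over [W] too. Weights stay real in the convexity argument; natural exponents of [t] are
    recovered by scaling and rounding, which the strict inequality allows. *)

Section PatternMatrices.
Variables (F : fieldType) (n : nat).
Implicit Types (e : rel 'I_n) (A B : 'M[F]_n).

(** When [e] is a preorder these matrices form an algebra. The Borel, parabolic and opposite
    unipotent groups below are all cut out by such conditions, so products and inverses are treated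
    once. *)
Definition pattern e A := forall k l, A k l != 0 -> e k l.

Lemma patternM e A B : transitive e -> pattern e A -> pattern e B ->
  pattern e (A *m B).
Proof.
move=> tr hA hB k l; rewrite mxE => nz.
have [j /andP[Aj Bj]] : exists j, (A k j != 0) && (B j l != 0).
  apply/existsP; apply: contra_neqT nz => /existsPn h; apply: big1 => j _.
  move: (h j); rewrite negb_and !negbK => /orP[] /eqP ->;
  by rewrite ?mul0r ?mulr0.
exact: tr (hA _ _ Aj) (hB _ _ Bj).
Qed.

Lemma pattern_scalar e c : reflexive e -> pattern e c%:M.
Proof.
by move=> re k l; rewrite mxE; case: (k =P l) => [->|_] //; rewrite mulr0n eqxx.
Qed.

Lemma patternD e A B : pattern e A -> pattern e B -> pattern e (A + B).
Proof.
move=> hA hB k l; rewrite mxE => nz; have [Ak|/hA//] := eqVneq (A k l) 0.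
by apply: hB; move: nz; rewrite Ak add0r.
Qed.

End PatternMatrices.

(* Cayley-Hamilton: the inverse of a matrix is a polynomial in it. *)
Lemma pattern_inv (F : fieldType) (n : nat) (e : rel 'I_n) (A : 'M[F]_n) :
  reflexive e -> transitive e -> A \in unitmx -> pattern e A ->
  pattern e (invmx A).
Proof.
case: n e A => [|n] e A re tr uA hA; first by move=> [].
have hp (p : {poly F}) : pattern e (horner_mx A p).
  elim/poly_ind: p => [|p c IH]; first by rewrite rmorph0 => k l; rewrite mxE eqxx.
  rewrite rmorphD rmorphM /= horner_mx_X horner_mx_C.
  by apply: patternD; [apply: patternM|apply: pattern_scalar].
pose c := (char_poly A)`_0.
have c0 : c != 0.
  by rewrite /c char_poly_det mulf_neq0 // ?signr_eq0 // -unitfE -unitmxE.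
have [q def_q] : exists q, char_poly A = q * 'X + c%:P.
  exists (\poly_(i < size (char_poly A)) (char_poly A)`_i.+1).
  apply/polyP => i; rewrite coefD coefMX coefC; case: i => [|i] /=; first by rewrite add0r.
  rewrite addr0 coef_poly; case: ltnP => // le.
  by rewrite nth_default // (leq_trans le).
have := Cayley_Hamilton A; rewrite def_q rmorphD rmorphM /= horner_mx_X horner_mx_C.
move/eqP; rewrite addr_eq0 => /eqP eq.
have -> : invmx A = (- c^-1)%:M *m horner_mx A q.
  rewrite -[LHS]mul1mx; apply: (canLR (mulmxK _)) => //.
  rewrite -mulmxA; have -> : horner_mx A q *m A = - c%:M by exact: eq.
  by rewrite mulmxN -scalar_mxM mulNr mulVf // raddfN opprK.
exact: patternM (pattern_scalar _) (hp _).
Qed.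

Definition ord_le (n : nat) : rel 'I_n := fun k l => (k <= l)%N.

Lemma upper_unitmx (F : fieldType) (n : nat) (A : 'M[F]_n) :
  pattern (@ord_le n) A -> (forall k, A k k != 0) -> A \in unitmx.
Proof.
move=> up nz; rewrite -unitmx_tr unitmxE det_trig.
  by rewrite unitfE; apply/prodf_neq0 => k _; rewrite mxE.
apply/is_trig_mxP => k l lt; rewrite mxE; apply/eqP; apply: contraTT lt.
by move/up; rewrite /ord_le -leqNgt.
Qed.

(** Borders [A] by a pivot [1] at [(k, k)], so that operations on a minor avoiding row [k] act on
    the full matrix. *)
Definition lift_mx (F : fieldType) (n : nat) (k : 'I_n.+1) (A : 'M[F]_n) :
    'M[F]_n.+1 :=
  \matrix_(i, j) match unlift k i, unlift k j with
    | Some i', Some j' => A i' j'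
    | None, None => 1
    | _, _ => 0 end.

Lemma lift_mx_upper (F : fieldType) (n : nat) (k : 'I_n.+1) (A : 'M[F]_n) :
  pattern (@ord_le n) A -> pattern (@ord_le n.+1) (lift_mx k A).
Proof.
move=> up i j; rewrite mxE.
case: unliftP => [i'|] ->; case: unliftP => [j'|] ->; rewrite ?eqxx //.
  by move/up; rewrite /ord_le /= leq_bump2.
by move=> _; rewrite /ord_le.
Qed.

(** The inductive step of the Bruhat decomposition: once the row and the column of a pivot are
    clear, operations on the complementary minor do not disturb them. *)
Lemma lift_mxM (F : fieldType) (n : nat) (k l : 'I_n.+1) (A B : 'M[F]_n)
    (M : 'M[F]_n.+1) :
  (forall i, M i l = (i == k)%:R) -> (forall j, M k j = (j == l)%:R) ->
  let N := lift_mx k A *m M *m lift_mx l B in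
  [/\ forall i, N i l = (i == k)%:R, forall j, N k j = (j == l)%:R &
      row' k (col' l N) = A *m row' k (col' l M) *m B].
Proof.
move=> cM rM N.
have eL i j : (lift_mx k A *m M) i j = match unlift k i with
    | Some i' => \sum_h A i' h * M (lift k h) j | None => M k j end.
  rewrite mxE (bigD1_ord k) //= !mxE unlift_none.
  case: unliftP => [i'|] ei; rewrite ?mul0r ?mul1r ?add0r.
    by apply: eq_bigr => h _; rewrite mxE liftK ei liftK.
  by rewrite big1 ?addr0 // => h _; rewrite mxE liftK ei unlift_none mul0r.
have eN i j : N i j = match unlift l j with
    | Some j' => \sum_h (lift_mx k A *m M) i (lift l h) * B h j'
    | None => (lift_mx k A *m M) i l end.
  rewrite mxE (bigD1_ord l) //= [lift_mx l B _ _]mxE unlift_none.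
  case: unliftP => [j'|] ej; rewrite ?mulr0 ?mulr1 ?add0r.
    by apply: eq_bigr => h _; rewrite [lift_mx l B _ _]mxE liftK ej liftK.
  rewrite big1 ?addr0 // => h _.
  by rewrite [lift_mx l B _ _]mxE liftK ej unlift_none mulr0.
split=> [i|j|].
- rewrite eN unlift_none eL; case: unliftP => [i'|] -> //.
  rewrite big1 => [|h _]; last by rewrite cM eq_sym (negPf (neq_lift _ _)) mulr0.
  by rewrite eq_sym (negPf (neq_lift _ _)).
- rewrite eN; case: unliftP => [j'|] ->; last by rewrite eL unlift_none rM eqxx.
  rewrite big1 => [|h _]; first by rewrite eq_sym (negPf (neq_lift _ _)).
  by rewrite eL unlift_none rM eq_sym (negPf (neq_lift _ _)) mul0r.
- apply/matrixP => i j; rewrite [LHS]mxE [LHS]mxE eN liftK [RHS]mxE.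
  apply: eq_bigr => h _; rewrite eL liftK [in RHS]mxE; congr (_ * _); apply: eq_bigr => h' _.
  by rewrite !mxE.
Qed.

(* In the first column of an invertible matrix take the lowest nonzero entry as
   pivot: it can be used to clear its column by upper triangular row operations
   and its row by upper triangular column operations. *)
Lemma bruhat_decomposition (F : fieldType) (n : nat) (A : 'M[F]_n) :
  A \in unitmx ->
  exists b1 b2 (s : 'S_n), [/\ b1 \in unitmx, b2 \in unitmx,
    pattern (@ord_le n) b1, pattern (@ord_le n) b2 & b1 *m A *m b2 = perm_mx s].
Proof.
move=> uA.
suff [b1 [b2 [s [u1 u2 e]]]] : exists b1 b2 (s : 'S_n), [/\ pattern (@ord_le n) b1,
    pattern (@ord_le n) b2 & b1 *m A *m b2 = perm_mx s].
  have us : (perm_mx s : 'M[F]_n) \in unitmx by exact: (unitmx_perm F s).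
 exists b1, b2, s; move: us.
  by rewrite -e !unitmx_mul => /andP[/andP[-> _] ->].
elim: n A uA => [|n IH] A uA.
  by exists 1%:M, 1%:M, 1%g; split; [move=> []|move=> []|apply/matrixP => -[]].
have [k0 Ak0] : exists k, A k ord0 != 0.
  apply/existsP; apply: contraTT uA => /existsPn h.
  rewrite unitmxE (expand_det_col _ ord0) big1 ?unitr0 // => k _.
  by move: (h k); rewrite negbK => /eqP ->; rewrite mul0r.
pose k := [arg max_(k > k0 | A k ord0 != 0) (k : nat)].
have [Ak kmax] : A k ord0 != 0 /\ forall i, A i ord0 != 0 -> (i <= k)%N.
  by rewrite /k; case: arg_maxnP.
pose X : 'M[F]_n.+1 := \matrix_(i, j)
  if j == k then (if i == k then (A k ord0)^-1 else - A i ord0 / A k ord0)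
  else (i == j)%:R.
have upX : pattern (@ord_le n.+1) X.
  move=> i j; rewrite mxE /ord_le; have [->|jk] := eqVneq j k.
    have [->//|ik] := eqVneq i k; rewrite mulf_eq0 negb_or oppr_eq0 => /andP[/kmax //].
  by case: (i =P j) => [->|_] //; rewrite eqxx.
have uX : X \in unitmx.
  apply: upper_unitmx => // i; rewrite mxE; have [_|ik] := eqVneq i k.
    by rewrite invr_eq0.
  by rewrite eqxx oner_eq0.
have eX i j : (X *m A) i j =
    if i == k then A k j / A k ord0 else A i j - A i ord0 / A k ord0 * A k j.
  rewrite mxE (bigD1 k) //= [X i k]mxE eqxx; have [->|ik] := eqVneq i k.
    by rewrite big1 ?addr0 1?mulrC // => h hk; rewrite mxE (negPf hk) eq_sym (negPf hk) mul0r.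
  rewrite (bigD1 i) //= mxE (negPf ik) eqxx mul1r big1 => [|h /andP[hk hi]].
    by rewrite addr0 addrC !mulNr.
  by rewrite mxE (negPf hk) eq_sym (negPf hi) mul0r.
pose Y : 'M[F]_n.+1 := \matrix_(i, j)
  if (i == ord0) && (j != ord0) then - (X *m A) k j else (i == j)%:R.
have upY : pattern (@ord_le n.+1) Y.
  move=> i j; rewrite mxE /ord_le; have [->//|i0] /= := eqVneq i ord0.
  by case: (i =P j) => [->|_] //; rewrite eqxx.
have uY : Y \in unitmx.
  apply: upper_unitmx => // i; rewrite mxE; have [_|i0] /= := eqVneq i ord0.
    by rewrite eqxx oner_eq0.
  by rewrite eqxx oner_eq0.
have eY i j : (X *m A *m Y) i j =
    if j == ord0 then (X *m A) i ord0
    else (X *m A) i j - (X *m A) i ord0 * (X *m A) k j.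
  rewrite mxE (bigD1 ord0) //= [Y ord0 _]mxE eqxx /=; have [->|j0] /= := eqVneq j ord0.
    rewrite mulr1 big1 ?addr0 // => h h0.
    by rewrite [Y _ _]mxE andbF (negPf h0) mulr0.
  rewrite (bigD1 j) //= [Y _ _]mxE (negPf j0) /= eqxx mulr1 big1 => [|h /andP[h0 hj]].
    by rewrite addr0 addrC mulrN.
  by rewrite [Y _ _]mxE (negPf h0) /= (negPf hj) mulr0.
pose M := X *m A *m Y.
have uM : M \in unitmx by rewrite !unitmx_mul uX uA.
have cM i : M i ord0 = (i == k)%:R.
  rewrite eY eqxx eX; have [_|ik] := eqVneq i k; first by rewrite mulfV.
  by rewrite mulfVK // subrr.
have rM j : M k j = (j == ord0)%:R.
  have := cM k; rewrite eqxx /M !eY /= => ->.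
  by case: eqVneq => // _; rewrite mul1r subrr.
have uM' : row' k (col' ord0 M) \in unitmx.
  move: uM; rewrite unitmxE (expand_det_col _ ord0) (bigD1 k) //= cM eqxx mul1r.
  rewrite big1 => [|h hk]; last by rewrite cM (negPf hk) mul0r.
  by rewrite addr0 unitrM => /andP[_]; rewrite -unitmxE.
have [b1 [b2 [s [up1 up2 e]]]] := IH _ uM'.
exists (lift_mx k b1 *m X), (Y *m lift_mx ord0 b2), (lift_perm k ord0 s).
have tr m : transitive (@ord_le m) by move=> ? ? ?; apply: leq_trans.
split; [exact: patternM (@tr _) (lift_mx_upper up1) upX|
  exact: patternM (@tr _) upY (lift_mx_upper up2)|].
have -> : lift_mx k b1 *m X *m A *m (Y *m lift_mx ord0 b2) =
    lift_mx k b1 *m M *m lift_mx ord0 b2 by rewrite /M !mulmxA.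
have [cN rN eN] := lift_mxM b1 b2 cM rM.
apply/matrixP => i j; rewrite [RHS]mxE [RHS]mxE.
case: (unliftP k i) => [i'|] ->; last by rewrite rN lift_perm_id eq_sym.
rewrite lift_perm_lift; case: (unliftP ord0 j) => [j'|] ->.
  have /matrixP/(_ i' j') := eN; rewrite e !mxE (inj_eq lift_inj) => <-.
  by [].
by rewrite cN eq_sym (negPf (neq_lift _ _)) eq_sym (negPf (neq_lift _ _)).
Qed.

(** An LUP decomposition of the inverse writes [g] as upper triangular times lower unipotent times
    permutation. The entries of the lower factor between equal weights form its Levi part, which is
    absorbed into the parabolic factor [p]; what remains is [u] in the opposite unipotent
    radical. *)
Lemma coset_representative (R : realType) (F : fieldType) (n : nat)
    (a : 'I_n -> R) (g : 'M[F]_n) :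
  {homo a : k l / (k <= l)%N >-> l <= k} -> g \in unitmx ->
  exists p u (s : 'S_n), [/\ p \in unitmx, pattern (fun k l => a l <= a k) p,
    pattern (fun k l => (k == l) || (a k < a l)) u, forall k, u k k = 1 &
    g = p *m u *m perm_mx s].
Proof.
case: n a g => [|n] a g srt ug.
  exists 1%:M, 1%:M, 1%g; split; [exact: unitmx1|by move=> []|by move=> []|by move=> []|].
  by apply/matrixP => -[].
have := cormen_lup_perm (invmx g); have := cormen_lup_correct (invmx g).
have := cormen_lup_detL (invmx g).
have := @cormen_lup_lower _ _ (invmx g); have := @cormen_lup_upper _ _ (invmx g).
case: (cormen_lup _) => -[P L] U /= upU loL dL eq /is_perm_mxP[s eP].
have uL : L \in unitmx by rewrite unitmxE dL unitr1.
have uU : U \in unitmx.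
  have : L *m U \in unitmx by rewrite -[_ *m _]eq eP unitmx_mul unitmx_perm unitmx_inv.
  by rewrite unitmx_mul uL.
have eg : g = invmx U *m invmx L *m perm_mx s.
  have h : invmx U *m invmx L *m P *m invmx g = 1%:M.
    by rewrite -mulmxA [P *m _]eq -mulmxA (mulmxA (invmx L)) mulVmx // mul1mx mulVmx.
  by rewrite -[RHS](mulmxKV ug) -eP h mul1mx.
have tr : transitive (@ord_le n.+1) by move=> ? ? ?; apply: leq_trans.
have pL : pattern (fun k l => (l <= k)%N) (invmx L).
  apply: pattern_inv => // [x y z h h'|k l]; first exact: leq_trans h' h.
  by apply: contraR; rewrite -ltnNge => lt; rewrite loL ?(ltnW lt) // -val_eqE (ltn_eqF lt).
set u := invmx L in pL eg.
have uu : u \in unitmx by rewrite unitmx_inv.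
have u1 k : u k k = 1.
  have /matrixP/(_ k k) := mulmxV uL; rewrite !mxE eqxx (bigD1 k) //= loL // eqxx mul1r.
  rewrite big1 ?addr0 // => j jk; have [kj|jk'] := leqP k j.
    by rewrite loL // eq_sym (negPf jk) mul0r.
  rewrite -/u; have [->|/pL] := eqVneq (u j k) 0; rewrite ?mulr0 //.
  by rewrite leqNgt jk'.
pose d : 'M[F]_n.+1 := \matrix_(k, l) if a k == a l then u k l else 0.
have pd : pattern (fun k l => a k == a l) d.
  by move=> k l; rewrite mxE; case: (a k == a l); rewrite // eqxx.
have ud : d \in unitmx.
  rewrite unitmxE det_trig.
    by rewrite big1 ?unitr1 // => k _; rewrite mxE eqxx.
  apply/is_trig_mxP => k l lt; rewrite mxE; case: (_ == _) => //.
  by apply/eqP; apply: contraTT lt => /pL; rewrite -leqNgt.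
have pdi : pattern (fun k l => a k == a l) (invmx d).
  by apply: pattern_inv => // x y z /eqP-> /eqP->.
pose w := invmx d *m (u - d).
have pw : pattern (fun k l => a k < a l) w.
  move=> k l; rewrite mxE => nz.
  have [j /andP[dj uj]] : exists j, (invmx d k j != 0) && ((u - d) j l != 0).
    apply/existsP; apply: contra_neqT nz => /existsPn h; apply: big1 => j _.
    move: (h j); rewrite negb_and !negbK => /orP[] /eqP ->;
    by rewrite ?mul0r ?mulr0.
  have /eqP -> := pdi _ _ dj; move: uj; rewrite !mxE.
  have [_|ne] := eqVneq (a j) (a l); first by rewrite subrr eqxx.
  by rewrite subr0 => /pL /srt; rewrite le_eqVlt (negPf ne).
exists (invmx U *m d), (1%:M + w), s; split.
- by rewrite unitmx_mul unitmx_inv uU.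
- apply: patternM => [x y z h1 h2|k l|k l /pd /eqP ->//]; first exact: le_trans h2 h1.
  have pU : pattern (@ord_le n.+1) (invmx U).
    by apply: pattern_inv => // k' l'; apply: contraR; rewrite /ord_le -ltnNge => lt; rewrite upU.
  by move/pU/srt.
- move=> k l; rewrite mxE [X in X + _]mxE.
  by have [//|_] /= := eqVneq k l; rewrite add0r; apply: pw.
- move=> k; rewrite [LHS]mxE [X in X + _]mxE eqxx.
  by have [->|/pw] := eqVneq (w k k) 0; rewrite ?addr0 // ltxx.
- rewrite eg; congr (_ *m _); rewrite -mulmxA; congr (_ *m _).
  by rewrite mulmxDr mulmx1 /w mulKVmx // addrC subrK.
Qed.

(** * Triangular and diagonal forms when divisibility is total *)

Section ChainRing.
Variable R : comUnitRingType.
Hypothesis chain : forall x y : R, (exists c, y = c * x) \/ (exists c, x = c * y).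

Lemma chain_divides (T : finType) (f : T -> R) (i0 : T) :
  exists i, forall j, exists c, f j = c * f i.
Proof.
suff [i hi] : exists i, forall j, j \in enum T -> exists c, f j = c * f i.
  by exists i => j; apply: hi; rewrite mem_enum.
elim: (enum T) => [|k s [i IH]]; first by exists i0.
have [[c ec]|[c ec]] := chain (f i) (f k).
  by exists i => j; rewrite inE => /orP[/eqP->|/IH//]; exists c.
exists k => j; rewrite inE => /orP[/eqP->|/IH[c' ->]]; first by exists 1; rewrite mul1r.
by exists (c' * c); rewrite ec mulrA.
Qed.

(** Some entry of the first column divides the others, so elimination never leaves the ring. Applied
    to a valuation ring, this yields the Iwasawa decomposition. *)
Lemma chain_triangular (n : nat) (A : 'M[R]_n) :
  exists2 k, k \in unitmx & forall i j : 'I_n, (j < i)%N -> (k *m A) i j = 0.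
Proof.
elim: n A => [|n IH] A; first by exists 1%:M; [exact: unitmx1|case].
have [i hi] := chain_divides (fun i => A i ord0) ord0.
pose A1 : 'M_(1 + n) := tperm_mx ord0 i *m A.
have [c hc] : exists c : 'cV_n, forall k, A1 (rshift 1 k) ord0 = c k 0 * A1 ord0 ord0.
  have h (k : 'I_n) : exists c, A1 (rshift 1 k) ord0 = c * A1 ord0 ord0.
    by rewrite /A1 -row_permE !mxE tpermL; exact: hi.
  have [c hc] := boolp.choice h; exists (\col_k c k) => k; rewrite mxE; exact: hc.
have eA1 : tperm_mx ord0 i *m A = A1 by [].
clearbody A1.
pose k1 : 'M[R]_(1 + n) := block_mx 1%:M 0 (- c) 1%:M.
have uk1 : k1 \in unitmx by rewrite unitmxE det_lblock !det1 mulr1 unitr1.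
have ek1 : k1 *m A1 = block_mx (ulsubmx A1) (ursubmx A1) 0 (- c *m ursubmx A1 + drsubmx A1).
  rewrite -{1}[A1]submxK mulmx_block !mul1mx !mul0mx !addr0; congr block_mx.
  apply/matrixP => k l; rewrite !mxE big_ord1 !mxE !ord1 !lshift0; rewrite hc mulNr.
  by rewrite addNr.
have [k' uk' hk'] := IH (- c *m ursubmx A1 + drsubmx A1).
pose k2 : 'M[R]_(1 + n) := block_mx 1%:M 0 0 k'.
have uk2 : k2 \in unitmx by rewrite unitmxE det_lblock det1 mul1r -unitmxE.
exists (k2 *m k1 *m tperm_mx ord0 i) => [|x y].
  by rewrite !unitmx_mul uk1 uk2 unitmx_perm.
have eK : k2 *m (k1 *m A1) = block_mx (ulsubmx A1) (ursubmx A1) 0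
    (k' *m (- c *m ursubmx A1 + drsubmx A1)).
  by rewrite ek1 /k2 mulmx_block !mul1mx !mul0mx mulmx0 !addr0 !add0r.
have -> : k2 *m k1 *m tperm_mx ord0 i *m A = k2 *m (k1 *m A1).
  by rewrite -eA1 !mulmxA.
rewrite eK; move: x y.
suff trig : forall x y : 'I_(1 + n), (y < x)%N -> block_mx (ulsubmx A1) (ursubmx A1) 0
    (k' *m (- c *m ursubmx A1 + drsubmx A1)) x y = 0 by exact: trig.
move=> x y; case: (@split_ordP 1 n x) => x' ->; first by rewrite !ord1.
case: (@split_ordP 1 n y) => y' ->; first by rewrite block_mxEdl mxE.
by rewrite block_mxEdr => lt; apply: hk'.
Qed.

(** Pivoting on an entry that divides all others clears its row and its column. For [K[[t]]] this is
    the Smith normal form, without the divisibility between successive diagonal entries. *)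
Lemma chain_diagonal (n : nat) (A : 'M[R]_n) :
  exists k h, [/\ k \in unitmx, h \in unitmx & is_diag_mx (k *m A *m h)].
Proof.
elim: n A => [|n IH] A; first by exists 1%:M, 1%:M; split; rewrite ?unitmx1 //; apply/is_diag_mxP => -[].
have [[i j] hij] := chain_divides (fun ij => A ij.1 ij.2) (ord0, ord0).
pose A1 : 'M_(1 + n) := col_perm (tperm ord0 j) (row_perm (tperm ord0 i) A).
have dA x y : exists c, A1 x y = c * A1 ord0 ord0.
  by rewrite !mxE !tpermL; exact: (hij (_, _)).
have [c hc] : exists c : 'cV_n, forall k, A1 (rshift 1 k) ord0 = c k 0 * A1 ord0 ord0.
  have [c hc] := boolp.choice (fun k : 'I_n => dA (rshift 1 k) ord0).
  by exists (\col_k c k) => k; rewrite mxE; exact: hc.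
have [b hb] : exists b : 'rV_n, forall k, A1 ord0 (rshift 1 k) = b 0 k * A1 ord0 ord0.
  have [b hb] := boolp.choice (fun k : 'I_n => dA ord0 (rshift 1 k)).
  by exists (\row_k b k) => k; rewrite mxE; exact: hb.
have eA1 : tperm_mx ord0 i *m A *m tperm_mx ord0 j = A1.
  by rewrite /A1 col_permE row_permE tpermV.
clearbody A1; pose k1 : 'M[R]_(1 + n) := block_mx 1%:M 0 (- c) 1%:M.
pose h1 : 'M[R]_(1 + n) := block_mx 1%:M (- b) 0 1%:M.
have uk1 : k1 \in unitmx by rewrite unitmxE det_lblock !det1 mulr1 unitr1.
have uh1 : h1 \in unitmx by rewrite unitmxE det_ublock !det1 mulr1 unitr1.
have [D eD] : exists D, k1 *m A1 *m h1 = block_mx (ulsubmx A1) 0 0 D.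
  rewrite -[A1]submxK /k1 mulmx_block !mul1mx !mul0mx !addr0 submxK.
  set D0 := - c *m ursubmx A1 + _.
  have -> : - c *m ulsubmx A1 + dlsubmx A1 = 0.
    apply/matrixP => k l; rewrite !mxE big_ord1 !mxE !ord1 !lshift0; rewrite hc mulNr.
    by rewrite addNr.
  exists D0; rewrite /h1 mulmx_block !mulmx1 !mulmx0 !mul0mx !addr0 !add0r.
  congr block_mx; apply/matrixP => k l.
  by rewrite !mxE big_ord1 !mxE !ord1 !lshift0 hb mulrN mulrC addNr.
have [k' [h' [uk' uh' dg]]] := IH D.
pose k2 : 'M[R]_(1 + n) := block_mx 1%:M 0 0 k'.
pose h2 : 'M[R]_(1 + n) := block_mx 1%:M 0 0 h'.
have uk2 : k2 \in unitmx by rewrite unitmxE det_lblock det1 mul1r -unitmxE.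
have uh2 : h2 \in unitmx by rewrite unitmxE det_lblock det1 mul1r -unitmxE.
exists (k2 *m k1 *m tperm_mx ord0 i), (tperm_mx ord0 j *m h1 *m h2); split.
- by rewrite !unitmx_mul uk1 uk2 unitmx_perm.
- by rewrite !unitmx_mul uh1 uh2 unitmx_perm.
have -> : k2 *m k1 *m tperm_mx ord0 i *m A *m (tperm_mx ord0 j *m h1 *m h2) =
    k2 *m (k1 *m A1 *m h1) *m h2.
  by rewrite -eA1 !mulmxA.
have eK : k2 *m (k1 *m A1 *m h1) *m h2 = block_mx (ulsubmx A1) 0 0 (k' *m D *m h').
  rewrite eD /k2 /h2 !mulmx_block !mulmx1 !mul1mx !mulmx0 !mul0mx.
  by rewrite !addr0 !add0r !mul0mx.
rewrite eK.
apply/is_diag_mxP; suff dgb : forall x y : 'I_(1 + n), x != y :> nat ->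
    block_mx (ulsubmx A1) 0 0 (k' *m D *m h') x y = 0 by exact: dgb.
move=> x y; case: (@split_ordP 1 n x) => x' ->; case: (@split_ordP 1 n y) => y' -> ne.
- by rewrite !ord1 eqxx in ne.
- by rewrite block_mxEur mxE.
- by rewrite block_mxEdl mxE.
- by rewrite block_mxEdr; move/is_diag_mxP: dg; apply; rewrite -(eqn_add2l 1).
Qed.

End ChainRing.

(** * The tensor action *)

Section TensorAction.
Variables (d : nat) (n : 'I_d -> nat).

Lemma sum_mindex_prod (A : comNzRingType) (F : forall i : 'I_d, 'I_(n i) -> A) :
  \sum_(k : mindex n) \prod_(i < d) F i (k i) = \prod_(i < d) \sum_l F i l.
Proof.
pose F' i := [ffun l : 'I_(n i) => F i l].
transitivity (\sum_(k : mindex n) \prod_(i < d) F' i (k i)).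
  by apply: eq_bigr => k _; apply: eq_bigr => i _; rewrite ffunE.
rewrite (reindex (@dffun_of_fprod _ _)); last exact/onW_bij/dffun_of_fprod_bij.
transitivity (\sum_(t : fprod (fun i => 'I_(n i))) \prod_(i < d) F' i (t i)).
  apply: eq_bigr => t _; apply: eq_bigr => i _; congr (F' i _).
  by rewrite /dffun_of_fprod ffunE.
rewrite big_fprod -(bigA_distr_big_dep _ (fun i => untag 0 (F' i))).
apply: eq_bigr => i _; transitivity (\sum_(l : 'I_(n i)) F' i l).
  exact/esym/(big_tag (fun i => F' i) i).
by apply: eq_bigr => l _; rewrite ffunE.
Qed.

Lemma tensor_actM (A : comNzRingType) (g h : forall i : 'I_d, 'M[A]_(n i))
    (v : tensor A n) :
  tensor_act (fun i => g i *m h i) v = tensor_act g (tensor_act h v).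
Proof.
apply/ffunP => j; rewrite !ffunE.
under [RHS]eq_bigr do rewrite ffunE big_distrr /=.
rewrite exchange_big /=; apply: eq_bigr => l _.
under [RHS]eq_bigr do rewrite mulrA -big_split /=.
rewrite -big_distrl /=; congr (_ * _).
rewrite (sum_mindex_prod (fun i m => g i (j i) m * h i m (l i))).
by apply: eq_bigr => i _; rewrite mxE.
Qed.

Lemma tensor_act_diag (A : comNzRingType) (D : forall i : 'I_d, 'M[A]_(n i))
    (v : tensor A n) (j : mindex n) :
  (forall i, is_diag_mx (D i)) ->
  tensor_act D v j = (\prod_(i < d) D i (j i) (j i)) * v j.
Proof.
move=> dg; rewrite ffunE (bigD1 j) //= [X in _ + X]big1 ?addr0 // => k kj.
have [i ki] : exists i, k i != j i.
  apply/existsP; apply: contra_neqT kj => /existsPn h; apply/ffunP => i.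
  by apply/eqP; move: (h i); rewrite negbK.
rewrite (bigD1 i) //=; move/is_diag_mxP: (dg i) => -> //; rewrite ?mul0r //.
by rewrite val_eqE eq_sym.
Qed.

Lemma tensor_act1 (A : comNzRingType) (v : tensor A n) :
  tensor_act (fun i => 1%:M) v = v.
Proof.
apply/ffunP => j; rewrite tensor_act_diag => [|i]; last exact: scalar_mx_is_diag.
by rewrite big1 ?mul1r // => i _; rewrite mxE eqxx.
Qed.

Lemma eq_tensor_act (A : comNzRingType) (g h : forall i : 'I_d, 'M[A]_(n i))
    (v : tensor A n) : (forall i, g i = h i) -> tensor_act g v = tensor_act h v.
Proof.
move=> e; apply/ffunP => j; rewrite !ffunE; apply: eq_bigr => k _.
by congr (_ * _); apply: eq_bigr => i _; rewrite e.
Qed.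

Lemma tensor_actK (A : comUnitRingType) (g : forall i : 'I_d, 'M[A]_(n i)) :
  (forall i, g i \in unitmx) ->
  cancel (@tensor_act A d n g) (tensor_act (fun i => invmx (g i))).
Proof.
move=> ug v; rewrite -tensor_actM -[RHS]tensor_act1.
by apply: eq_tensor_act => i; rewrite mulVmx.
Qed.

Definition tensor_map (A B : comNzRingType) (f : A -> B) (v : tensor A n) :
  tensor B n := [ffun j => f (v j)].

Lemma tensor_map_act (A B : comNzRingType) (f : {rmorphism A -> B})
    (g : forall i : 'I_d, 'M[A]_(n i)) (v : tensor A n) :
  tensor_map f (tensor_act g v) =
  tensor_act (fun i => map_mx f (g i)) (tensor_map f v).
Proof.
apply/ffunP => j; rewrite !ffunE rmorph_sum; apply: eq_bigr => k _.
rewrite !ffunE rmorphM rmorph_prod; congr (_ * _).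
by apply: eq_bigr => i _; rewrite mxE.
Qed.

Definition weight (R : nmodType) (a : forall i : 'I_d, 'I_(n i) -> R)
  (j : mindex n) : R := \sum_(i < d) a i (j i).

Lemma tensor_act_support (A : idomainType) (M : forall i : 'I_d, 'M[A]_(n i))
    (u : tensor A n) (j : mindex n) : tensor_act M u j != 0 ->
  exists k, u k != 0 /\ forall i, M i (j i) (k i) != 0.
Proof.
rewrite ffunE => nz.
have [k] : exists k : mindex n, (\prod_i M i (j i) (k i)) * u k != 0.
  apply/existsP; apply: contra_neqT nz => /existsPn h; apply: big1 => k _.
  by apply/eqP; move: (h k); rewrite negbK.
rewrite mulf_eq0 negb_or => /andP[/prodf_neq0 h uk].
by exists k; split=> // i; apply: h.
Qed.

(** The hypothesis on [M] says that it maps the weight filtration of [a] into that of [b]; for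
    [a = b] and [M] invertible this is membership in the parabolic subgroup of [a]. *)
Lemma weight_support (R : numDomainType) (A : idomainType)
    (M : forall i : 'I_d, 'M[A]_(n i)) (a b : forall i : 'I_d, 'I_(n i) -> R)
    (u : tensor A n) (x : R) :
  (forall i k l, M i k l != 0 -> a i l <= b i k) ->
  (forall j, u j != 0 -> x <= weight a j) ->
  forall j, tensor_act M u j != 0 -> x <= weight b j.
Proof.
move=> hM hu j /tensor_act_support[k [uk Mk]].
by apply: le_trans (hu k uk) _; apply: ler_sum => i _; apply: hM.
Qed.

End TensorAction.

(** * Residue fields and places *)

(** Maximality is stated as invertibility modulo the ideal, the form in which it makes the quotient
    a field. *)
Record maximal_ideal (R : comNzRingType) := MaximalIdeal {
  max_carrier : set R;
  max_0 : max_carrier 0;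
  max_B : forall x y, max_carrier x -> max_carrier y -> max_carrier (x - y);
  max_M : forall x y, max_carrier y -> max_carrier (x * y);
  max_1 : ~ max_carrier 1;
  max_V : forall x, ~ max_carrier x -> exists y, max_carrier (y * x - 1) }.

Section MaximalQuotient.
Variables (R : comNzRingType) (m : maximal_ideal R).

Definition max_pred : pred R := fun x => `[< max_carrier m x >].

Lemma max_idealr_closed : idealr_closed (max_pred : {pred R}).
Proof.
split; first exact/asboolP/max_0.
  by apply/negP => /asboolP; exact: max_1.
move=> c x y /asboolP xI /asboolP yI; apply/asboolP.
rewrite -[y]opprK -[- y]add0r; apply: max_B; first exact: max_M.
by apply: max_B => //; exact: max_0.
Qed.

HB.instance Definition _ := isIdealr.Build R max_pred max_idealr_closed.

Definition max_ideal : idealr R := max_pred.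

Definition max_quot : Type := {ideal_quot max_ideal}.
HB.instance Definition _ := GRing.ComNzRing.on max_quot.

Definition max_pi (x : R) : max_quot := \pi_({ideal_quot max_ideal})%qT x.

Lemma max_pi_eq0 x : max_pi x = 0 <-> max_carrier m x.
Proof.
rewrite -[X in _ = X](rmorph0 \pi_({ideal_quot max_ideal})%qT) /max_pi.
split=> [/eqP|h]; last apply/eqP.
  by rewrite -Quotient.idealrBE subr0 => /asboolP.
by rewrite -Quotient.idealrBE subr0; apply/asboolP.
Qed.

Lemma max_quot_unit (x : max_quot) : x != 0 -> exists y, y * x = 1.
Proof.
rewrite -[x](@reprK R {ideal_quot max_ideal}) => /eqP nz.
have [y hy] : exists y, max_carrier m (y * generic_quotient.repr x - 1).
  by apply: max_V => h; apply: nz; exact/max_pi_eq0.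
exists (max_pi y); apply/eqP; rewrite -subr_eq0; apply/eqP.
have := proj2 (max_pi_eq0 _) hy; rewrite /max_pi.
by rewrite rmorphB rmorphM rmorph1.
Qed.

Definition max_inv (x : max_quot) : max_quot :=
  if pselect (x != 0) is left h then projT1 (cid (max_quot_unit h)) else 0.

Lemma max_mulVf x : x != 0 -> max_inv x * x = 1.
Proof. by move=> h; rewrite /max_inv; case: pselect => // h'; case: cid. Qed.

Lemma max_inv0 : max_inv 0 = 0.
Proof. by rewrite /max_inv; case: pselect => // h; case/eqP: (h). Qed.

HB.instance Definition _ :=
  GRing.ComNzRing_isField.Build max_quot max_mulVf max_inv0.

End MaximalQuotient.

Lemma mk_rmorphism (R S : nzRingType) (f : R -> S) :
  zmod_morphism f -> monoid_morphism f -> exists g : {rmorphism R -> S}, g =1 f.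
Proof.
move=> fB fM.
pose mB := GRing.isZmodMorphism.Build R S f fB.
pose mM := GRing.isMonoidMorphism.Build R S f fM.
pose g : {rmorphism R -> S} := HB.pack f mB mM.
by exists g.
Qed.

Lemma maximal_quotient (R : comNzRingType) (m : maximal_ideal R) :
  exists (k : fieldType) (p : {rmorphism R -> k}),
    (forall y, exists x, p x = y) /\ (forall x, p x = 0 <-> max_carrier m x).
Proof.
exists (max_quot m); have [||p ep] := @mk_rmorphism R (max_quot m) (@max_pi R m).
- by move=> x y; rewrite /max_pi rmorphB.
- by split=> [|x y]; rewrite /max_pi ?rmorph1 ?rmorphM.
exists p; split=> [y|x]; last by rewrite ep; exact: max_pi_eq0.
by exists (generic_quotient.repr y); rewrite ep /max_pi reprK.
Qed.

Lemma rmorphism_factor (R S T : nzRingType) (p : {rmorphism R -> S})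
    (f : {rmorphism R -> T}) :
  (forall y, exists x, p x = y) -> (forall x, p x = 0 -> f x = 0) ->
  exists g : {rmorphism S -> T}, forall x, g (p x) = f x.
Proof.
move=> /boolp.choice[s ps] h.
have hE x y : p x = p y -> f x = f y.
  move=> e; apply/eqP; rewrite -subr_eq0 -rmorphB; apply/eqP/h.
  by rewrite rmorphB e subrr.
have [||g eg] := @mk_rmorphism S T (f \o s).
- by move=> x y /=; rewrite -rmorphB; apply: hE; rewrite rmorphB !ps.
- split=> [|x y] /=; first by rewrite -(rmorph1 f); apply: hE; rewrite ps rmorph1.
  by rewrite -rmorphM; apply: hE; rewrite rmorphM !ps.
by exists g => x; rewrite eg /=; apply: hE; rewrite ps.
Qed.

(** The case [p = 0] is included on purpose: in [local_extend] the ideal of relations may vanish,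
    and then any irreducible polynomial serves. *)
Lemma irreducible_factor (L : fieldType) (p : {poly L}) : size p != 1%N ->
  exists2 h : {poly L}, irreducible_poly h & h %| p.
Proof.
have [-> _|p0] := eqVneq p 0.
  exists 'X; last exact: dvdp0.
  split=> [|q q1 qX]; first by rewrite size_polyX.
  have : size q != 0%N.
    by rewrite size_poly_eq0; apply: contraTneq qX => ->; rewrite dvd0p polyX_eq0.
  move=> q0; have : (size q <= 2)%N.
    by have := dvdp_leq _ qX; rewrite polyX_eq0 size_polyX; apply.
  move: q1 q0 => /eqP q1 /eqP q0 q2; rewrite -dvdp_size_eqp // size_polyX.
  by move: (size q) q0 q1 q2 => [|[|[|?]]].
have [k] := ubnP (size p); elim: k p p0 => // k IH p p0 lt sp.
have [irr|nirr] := pselect (irreducible_poly p); first by exists p.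
have sp1 : (1 < size p)%N by rewrite ltn_neqAle eq_sym sp size_poly_gt0.
have [q [q1 qp neq]] : exists q : {poly L}, [/\ size q != 1%N, q %| p & ~~ (q %= p)].
  apply/not_existsP => h; apply: nirr; split=> // q q1 qp.
  by apply/negPn/negP => ne; apply: (h q).
have q0 : q != 0 by apply: contraNneq p0 => e; rewrite e dvd0p in qp.
have [|h irr hq] := IH q q0 _ q1; last by exists h => //; apply: dvdp_trans qp.
rewrite ltnS in lt; apply: leq_trans lt; rewrite ltn_neqAle dvdp_leq // andbT.
by rewrite dvdp_size_eqp.
Qed.

Lemma irreducible_maximal (L : fieldType) (h : {poly L}) : irreducible_poly h ->
  exists m : maximal_ideal {poly L}, max_carrier m = [set q | h %| q].
Proof.
move=> irr; have [h1 hirr] := irr.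
unshelve eexists.
  apply: (@MaximalIdeal _ [set q | h %| q]) => /=.
  - exact: dvdp0.
  - by move=> x y; exact: dvdp_sub.
  - by move=> x y; exact: dvdp_mull.
  - by rewrite dvdp1 => /eqP e; rewrite e in h1.
  - move=> x /negP nx; have : coprimep h x by rewrite irreducible_poly_coprime.
    case/Bezout_eq1_coprimepP => -[u v] /= e; exists v.
    by rewrite -e opprD addrCA subrr addr0 dvdpNr dvdp_mull.
by [].
Qed.

Lemma simple_extension (L : fieldType) (h : {poly L}) : irreducible_poly h ->
  exists (E : fieldType) (p : {rmorphism {poly L} -> E}),
    (forall y, exists x, p x = y) /\ (forall x, p x = 0 <-> h %| x).
Proof.
move=> irr; have [m em] := irreducible_maximal irr.
by have [E [p [sp kp]]] := maximal_quotient m; exists E, p; rewrite em in kp.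
Qed.

Section LocalPairs.
Variables (K F : fieldType) (iota : {rmorphism K -> F}).

(** [B] is a local ring with maximal ideal [I]; both are kept as subsets of [F], so that such pairs
    are ordered by inclusion. The last field says that the residue field is algebraic over [K]
    without forming it, which lets the property pass to unions of chains. *)
Record is_local (B I : set F) : Prop := IsLocal {
  lc_K : forall c, B (iota c);
  lc_B : forall x y, B x -> B y -> B (x - y);
  lc_M : forall x y, B x -> B y -> B (x * y);
  lc_IB : forall x, I x -> B x;
  lc_IS : forall x y, I x -> I y -> I (x - y);
  lc_IM : forall x y, B x -> I y -> I (x * y);
  lc_I1 : ~ I 1;
  lc_V : forall x, B x -> ~ I x -> B x^-1;
  lc_alg : forall x, B x -> exists2 p : {poly K}, p != 0 & I (map_poly iota p).[x] }.

(** [B] is the localization of the image of [ev] at the kernel of [phi], realized by fractions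
    inside [F]; the inclusion of kernels keeps the denominators nonzero. *)
Lemma local_of_place (A : comNzRingType) (ev : {rmorphism A -> F}) (k : fieldType)
    (phi : {rmorphism A -> k}) (j : {rmorphism K -> A}) :
  (forall c, ev (j c) = iota c) -> (forall a, ev a = 0 -> phi a = 0) ->
  (forall y, algebraicOver (phi \o j) y) ->
  exists B I, [/\ is_local B I, forall a, B (ev a) &
    forall a, phi a = 0 -> I (ev a)].
Proof.
move=> evj ker alg.
pose B := [set x | exists a s, phi s != 0 /\ x = ev a / ev s].
pose I := [set x | exists a s, [/\ phi s != 0, phi a = 0 & x = ev a / ev s]].
have evs s : phi s != 0 -> ev s != 0 by apply: contra_neq => /ker.
have B1 a : B (ev a) by exists a, 1; rewrite !rmorph1 oner_eq0 divr1.
have I1 a : phi a = 0 -> I (ev a).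
  by exists a, 1; rewrite !rmorph1 oner_eq0 divr1.
exists B, I; split=> //; split.
- by move=> c; rewrite -evj.
- move=> _ _ [a [s [hs ->]]] [b [t [ht ->]]]; exists (a * t - b * s), (s * t).
  rewrite !rmorphM rmorphB !rmorphM mulf_neq0 //; split=> //.
  by rewrite -[- (_ / _)]mulNr addf_div ?evs // mulNr.
- move=> _ _ [a [s [hs ->]]] [b [t [ht ->]]]; exists (a * b), (s * t).
  by rewrite !rmorphM mulf_neq0 //; split=> //; rewrite mulf_div.
- by move=> x [a [s [hs _ ->]]]; exists a, s.
- move=> _ _ [a [s [hs ha ->]]] [b [t [ht hb ->]]]; exists (a * t - b * s), (s * t).
  rewrite !rmorphM !rmorphB !rmorphM mulf_neq0 // ha hb !mul0r subrr; split=> //.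
  by rewrite -[- (_ / _)]mulNr addf_div ?evs // mulNr.
- move=> _ _ [a [s [hs ->]]] [b [t [ht hb ->]]]; exists (a * b), (s * t).
  by rewrite !rmorphM mulf_neq0 // hb mulr0; split=> //; rewrite mulf_div.
- move=> [a [s [hs ha e]]]; case/eqP: (hs); rewrite -[LHS]subr0 -[X in _ - X]ha -rmorphB.
  apply: ker; rewrite rmorphB -[ev s]mul1r e mulfVK ?evs //; exact: subrr.
- move=> _ [a [s [hs ->]]] nI; have ha : phi a != 0.
    by apply/eqP => ha; apply: nI; exists a, s.
  by exists s, a; rewrite invf_div.
- move=> _ [a [s [hs ->]]]; have [p p0 rp] := alg (phi a / phi s).
  exists p => //.
  (* Clearing denominators in parallel in [F] and in [k] turns the vanishing of [p] at the residue
     into membership in [I]. *)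
  have : exists b t, [/\ phi t != 0,
      (map_poly iota p).[ev a / ev s] = ev b / ev t &
      (map_poly (phi \o j) p).[phi a / phi s] = phi b / phi t].
    elim/poly_ind: p {p0 rp} => [|p c [b [t [ht e1 e2]]]].
      exists 0, 1; rewrite !map_poly0 !horner0 !rmorph0 !rmorph1 !mul0r oner_eq0.
      by [].
    exists (b * a + j c * (t * s)), (t * s).
    rewrite !rmorphM mulf_neq0 //; split=> //.
      rewrite rmorphD rmorphM /= map_polyX map_polyC hornerMXaddC e1 /= -evj.
      rewrite mulf_div rmorphD !rmorphM mulrDl mulfK // mulf_neq0 ?evs //.
    rewrite rmorphD rmorphM /= map_polyX map_polyC hornerMXaddC e2 /=.
    by rewrite mulf_div rmorphD !rmorphM mulrDl mulfK // mulf_neq0.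
  case=> b [t [ht -> eb]]; exists b, t; split=> //.
  move/rootP: rp; rewrite eb => /eqP; rewrite mulf_eq0 invr_eq0 (negPf ht) orbF.
  by move/eqP.
Qed.

End LocalPairs.

Record subring (F : fieldType) := Subring {
  sr_set : set F;
  sr_1 : sr_set 1;
  sr_B : forall x y, sr_set x -> sr_set y -> sr_set (x - y);
  sr_M : forall x y, sr_set x -> sr_set y -> sr_set (x * y) }.

Section SubringType.
Variables (F : fieldType) (S : subring F).

Definition sr_pred : pred F := fun x => `[< sr_set S x >].

Lemma sr_closed : subring_closed (sr_pred : {pred F}).
Proof.
split; first exact/asboolP/sr_1.
  by move=> x y /asboolP hx /asboolP hy; apply/asboolP/sr_B.
by move=> x y /asboolP hx /asboolP hy; apply/asboolP/sr_M.
Qed.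

HB.instance Definition _ := GRing.isSubringClosed.Build F sr_pred sr_closed.

Record sr_type : predArgType := SrType { sr_val :> F; _ : sr_val \in sr_pred }.

HB.instance Definition _ := [isSub for sr_val].
HB.instance Definition _ := [Choice of sr_type by <:].
HB.instance Definition _ := [SubChoice_isSubComNzRing of sr_type by <:].

Definition sr_unit : {pred sr_type} := [pred p | `[< exists q, q * p = 1 >]].

Definition sr_inv (p : sr_type) : sr_type :=
  if pselect (exists q, q * p = 1) is left h then projT1 (cid h) else p.

Lemma sr_mulVx : {in sr_unit, left_inverse 1 sr_inv *%R}.
Proof.
move=> p /asboolP hp; rewrite /sr_inv; case: pselect => // h.
by case: cid.
Qed.

Lemma sr_unitPl p q : q * p = 1 -> sr_unit p.
Proof. by move=> qp; apply/asboolP; exists q. Qed.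

Lemma sr_invr_out : {in [predC sr_unit], sr_inv =1 id}.
Proof.
move=> p; rewrite !inE => /asboolPn hp.
by rewrite /sr_inv; case: pselect => // /hp.
Qed.

HB.instance Definition _ := GRing.ComNzRing_hasMulInverse.Build sr_type
  sr_mulVx sr_unitPl sr_invr_out.

End SubringType.

Lemma subring_ring (F : fieldType) (S : subring F) :
  exists (O : comUnitRingType) (inc : {rmorphism O -> F}),
    injective inc /\ forall x, sr_set S x <-> exists y, inc y = x.
Proof.
exists (sr_type S), (\val : {rmorphism sr_type S -> F}); split; first exact: val_inj.
move=> x; split=> [Sx|[y <-]] /=; last by case: y => y yS; apply/asboolP.
have xS : x \in sr_pred S by apply/asboolP.
by exists (SrType xS).
Qed.

Lemma rmorphism_lift (A B F : nzRingType) (inc : {rmorphism B -> F})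
    (f : {rmorphism A -> F}) : injective inc -> (forall a, exists b, inc b = f a) ->
  exists g : {rmorphism A -> B}, forall a, inc (g a) = f a.
Proof.
move=> inj /boolp.choice[g hg].
have [||g' eg'] := @mk_rmorphism A B g.
- by move=> x y; apply: inj; rewrite rmorphB !hg rmorphB.
- by split=> [|x y]; apply: inj; rewrite ?rmorphM ?rmorph1 !hg ?rmorph1 ?rmorphM.
by exists g' => a; rewrite eg'.
Qed.

Section LocalPairTheory.
Variables (K F : fieldType) (iota : {rmorphism K -> F}).

Lemma local_residue (B I : set F) : is_local iota B I ->
  exists (O : comUnitRingType) (inc : {rmorphism O -> F}) (k : fieldType)
    (pi : {rmorphism O -> k}) (j : {rmorphism K -> O}),
    [/\ injective inc /\ (forall x, B x <-> exists y, inc y = x),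
      forall c, inc (j c) = iota c, forall y, exists x, pi x = y,
      forall x, pi x = 0 <-> I (inc x) &
      forall y, algebraicOver (pi \o j) y].
Proof.
move=> [BK BB BM IB IS IM nI1 BV alg].
have B1 : B 1 by rewrite -(rmorph1 iota).
have [O [inc [inj im]]] := subring_ring (Subring B1 BB BM).
have Binc y : B (inc y) by apply/im; exists y.
have I0 : I 0.
  have [p p0 Ip] := alg 1 B1; rewrite -(subrr (map_poly iota p).[1]); exact: IS.
have [m em] : exists m : maximal_ideal O, max_carrier m = [set x | I (inc x)].
  unshelve eexists; first apply: (@MaximalIdeal O [set x | I (inc x)]);
    last reflexivity; rewrite /=.
  - by rewrite rmorph0.
  - by move=> x y; rewrite rmorphB; exact: IS.
  - by move=> x y; rewrite rmorphM; apply: IM.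
  - by rewrite rmorph1.
  - move=> x nx; have [y ey] := proj1 (im _) (BV _ (Binc x) nx).
    exists y; rewrite rmorphB rmorphM rmorph1 ey mulVf ?subrr //.
    by apply/eqP => e; apply: nx; rewrite e.
have [k [pi [spi kpi]]] := maximal_quotient m; rewrite em in kpi.
have [|j hj] := @rmorphism_lift K O F inc iota inj.
  by move=> c; apply/im/BK.
exists O, inc, k, pi, j; split=> // y.
have [x <-] := spi y; have [p p0 Ip] := alg _ (Binc x).
exists p => //; apply/rootP.
have -> : (map_poly (pi \o j) p).[pi x] = pi (map_poly j p).[x].
  by rewrite -horner_map map_poly_comp.
apply/kpi => /=; rewrite -horner_map -map_poly_comp.
by rewrite (eq_map_poly (g := iota)).
Qed.

(** The relations of [x] over [B], reduced modulo [I], form an ideal of [k[X]]. If it contains [1],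
    a relation with coefficients in [I] takes the value [1] at [x]. Otherwise [x] can be sent to a
    root of an irreducible [h] dividing the whole ideal, and the new residue field [k[X]/(h)] is
    still algebraic over [K]. *)
Lemma local_extend (B I : set F) (x : F) : is_local iota B I ->
  (exists q : {poly F}, (forall i, I q`_i) /\ q.[x] = 1) \/
  exists B' I', [/\ is_local iota B' I', B `<=` B', I `<=` I' & B' x].
Proof.
move=> loc; have [O [inc [k [pi [j [[inj im] hj spi kpi alg]]]]]] := local_residue loc.
have [|nq] := pselect (exists q : {poly F}, (forall i, I q`_i) /\ q.[x] = 1); first by left.
right; pose ev : {rmorphism {poly O} -> F} := horner_eval x \o map_poly inc.
pose a := [set r : {poly k} | exists q, ev q = 0 /\ map_poly pi q = r].
have a0 : a 0 by exists 0; rewrite !rmorph0.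
have aD r s : a r -> a s -> a (r - s).
  by move=> [q [q0 <-]] [t [t0 <-]]; exists (q - t); rewrite !rmorphB q0 t0 subrr.
have spoly (s : {poly k}) : exists q, map_poly pi q = s.
  elim/poly_ind: s => [|s c [q <-]]; first by exists 0; rewrite rmorph0.
  have [b <-] := spi c; exists (q * 'X + b%:P).
  by rewrite rmorphD rmorphM /= map_polyX map_polyC.
have aM s r : a r -> a (s * r).
  move=> [q [q0 <-]]; have [t <-] := spoly s; exists (t * q).
  by rewrite !rmorphM q0 mulr0.
have a1 : ~ a 1.
  move=> [q [q0 q1]]; apply: nq; exists (map_poly inc (1 - q)); split.
    by move=> i; rewrite coef_map; apply/kpi; rewrite -coef_map rmorphB /= q1 rmorph1 subrr coef0.
  by rewrite -[LHS]/(ev (1 - q)) rmorphB q0 rmorph1 subr0.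
(* A generator of [a], found by descent on the size with Euclidean division; it is [0] when [a] is
   the zero ideal. *)
have [r [sr hr]] : exists r : {poly k}, size r != 1%N /\ forall s, a s -> r %| s.
  have [[r0 [ar0 nz]]|all0] := pselect (exists r, a r /\ r != 0); last first.
    exists 0; split=> [|s as_]; first by rewrite size_poly0.
    rewrite dvd0p; apply/negPn/negP => nz; apply: all0; by exists s.
  have [N] := ubnP (size r0); elim: N r0 ar0 nz => // N IH r ar nz; rewrite ltnS => le.
  have [dv|] := pselect (forall s, a s -> r %| s).
    exists r; split=> //; apply/negP => /size_poly1P[c c0 e]; apply: a1.
    have -> : 1 = c^-1%:P * r by rewrite e -polyCM mulVf.
    exact: aM.
  move=> /existsNP[s /not_implyP[as_ /negP ndv]]; apply: (IH (s %% r)) => //.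
    have -> : s %% r = s - s %/ r * r by rewrite {2}(divp_eq s r) addrC addKr.
    exact: aD (aM _ _ _).
  by apply: leq_trans le; rewrite ltn_modp.
have [h irr hdiv] := irreducible_factor sr.
have [E [p [sp kp]]] := simple_extension irr.
pose phi : {rmorphism {poly O} -> E} := p \o map_poly pi.
pose jP : {rmorphism K -> {poly O}} := polyC \o j.
have [||y|B' [I' [loc' hB hI]]] := @local_of_place K F iota _ ev E phi jP.
- by move=> c /=; rewrite /horner_eval map_polyC hornerC /= hj.
- by move=> q q0; apply/kp/(dvdp_trans hdiv)/hr; exists q.
- pose i0 : {rmorphism k -> E} := p \o polyC.
  have eQ : phi \o jP =1 i0 \o (pi \o j) by move=> c /=; rewrite map_polyC.
  have evp (s : {poly k}) : p s = (map_poly i0 s).[p 'X].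
    elim/poly_ind: s => [|s c e]; first by rewrite !rmorph0 horner0.
    by rewrite !rmorphD !rmorphM /= map_polyX map_polyC hornerMXaddC e.
  pose jj : {rmorphism K -> E} := phi \o jP.
  have intc c : integralOver jj (i0 c).
    apply/integral_algebraic; have [s s0 rs] := alg c; exists s => //.
    apply/rootP; rewrite (eq_map_poly (g := i0 \o (pi \o j))) // map_poly_comp.
    by rewrite horner_map (rootP rs) rmorph0.
  have intr (s : {poly k}) : {in map_poly i0 s : seq E, integralRange jj}.
    by apply/integral_poly => i; rewrite coef_map; exact: intc.
  have [s <-] := sp y; apply/(integral_algebraic jj); rewrite evp.
  apply: integral_horner (intr s) _.
  apply: integral_root (intr h); first by rewrite map_poly_eq0 irredp_neq0.
  by apply/rootP; rewrite -evp; apply/kp/dvdpp.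
exists B', I'; split=> //.
- move=> y /im[b <-]; have := hB b%:P.
  by rewrite /= /horner_eval map_polyC hornerC.
- move=> y Iy; have [b eb] := proj1 (im y) (lc_IB loc Iy).
  have := hI b%:P; rewrite /= /horner_eval !map_polyC hornerC /= eb; apply.
  by rewrite (proj2 (kpi b)) ?rmorph0 // eb.
- by have := hB 'X; rewrite /= /horner_eval map_polyX hornerX.
Qed.

End LocalPairTheory.

Section Place.
Variables (K F : fieldType) (iota : {rmorphism K -> F}).

(* Pairs [(B, I)] are encoded as subsets of [F * bool] for Zorn's lemma. *)
Lemma maximal_local (B0 I0 : set F) : is_local iota B0 I0 ->
  exists B I, [/\ is_local iota B I, B0 `<=` B, I0 `<=` I &
    forall B' I', is_local iota B' I' -> B `<=` B' -> I `<=` I' -> B' `<=` B].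
Proof.
move=> loc0.
pose BB (X : set (F * bool)) := [set x | X (x, true)].
pose II (X : set (F * bool)) := [set x | X (x, false)].
pose X0 : set (F * bool) := [set y | if y.2 then B0 y.1 else I0 y.1].
pose P := [set X | X = set0 \/ (is_local iota (BB X) (II X) /\ X0 `<=` X)].
have [|A [PA maxA]] := @Zorn_bigcup _ P.
  move=> C CP tot; pose U := \bigcup_(X in C) X.
  have [[X1 [CX1 [loc1 le1]]]|no] :=
    pselect (exists X, C X /\ (is_local iota (BB X) (II X) /\ X0 `<=` X)); last first.
    left; rewrite -subset0 => y [X CX Xy]; have [e|h] := CP X CX; first by rewrite e in Xy.
    by case: no; exists X.
  right; split; last by move=> y /le1; exists X1.
  have bigger (y z : F * bool) : U y -> U z -> exists X, [/\ C X,
      is_local iota (BB X) (II X), X y & X z].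
    move=> [X CX Xy] [Z CZ Zz].
    have locC W w : C W -> W w -> is_local iota (BB W) (II W).
      by move=> CW Ww; have [e|[]//] := CP W CW; rewrite e in Ww.
    have [XZ|ZX] := tot _ _ CX CZ.
      by exists Z; split=> //; [apply: locC Zz|apply: XZ].
    by exists X; split=> //; [apply: locC Xy|apply: ZX].
  split.
  - by move=> c; exists X1 => //; exact: (lc_K loc1).
  - move=> x y hx hy; have [X [CX loc Xx Xy]] := bigger _ _ hx hy.
    by exists X => //; exact: (lc_B loc).
  - move=> x y hx hy; have [X [CX loc Xx Xy]] := bigger _ _ hx hy.
    by exists X => //; exact: (lc_M loc).
  - move=> x hx; have [X [CX loc Xx Xy]] := bigger _ _ hx hx.
    by exists X => //; exact: (lc_IB loc).
  - move=> x y hx hy; have [X [CX loc Xx Xy]] := bigger _ _ hx hy.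
    by exists X => //; exact: (lc_IS loc).
  - move=> x y hx hy; have [X [CX loc Xx Xy]] := bigger _ _ hx hy.
    by exists X => //; exact: (lc_IM loc).
  - move=> h1; have [X [CX loc Xx Xy]] := bigger _ _ h1 h1.
    exact: (lc_I1 loc).
  - move=> x hx nx; have [X [CX loc Xx Xy]] := bigger _ _ hx hx.
    by exists X => //; apply: (lc_V loc) => // Ix; apply: nx; exists X.
  - move=> x hx; have [X [CX loc Xx Xy]] := bigger _ _ hx hx.
    by have [p p0 hp] := lc_alg loc Xx; exists p => //; exists X.
have X0A : X0 `<=` A.
  have [e|[]//] := PA; exfalso; apply: (maxA X0).
    rewrite e; split; first exact: sub0set.
    by move=> h; exact: (h (iota 0, true) (lc_K loc0 0)).
  by right; split.
have [e|[locA _]] := PA.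
  by have := X0A (iota 0, true) (lc_K loc0 0); rewrite e.
exists (BB A), (II A); split=> //.
- by move=> x Bx; apply: X0A.
- by move=> x Ix; apply: X0A.
move=> B' I' loc' hB hI x B'x; apply: contrapT => nx.
pose X' : set (F * bool) := [set y | if y.2 then B' y.1 else I' y.1].
apply: (maxA X').
  split; last by move=> h; apply: nx; exact: (h (x, true)).
  by move=> [y []] h; [apply: hB|apply: hI].
right; split=> //; move=> [y []] /= h; [apply: hB|apply: hI].
  exact: (X0A (y, true)).
exact: (X0A (y, false)).
Qed.

(** Certifies that [I] generates the unit ideal of [B[x]]; the degree bound [m] is what the descent
    below decreases. *)
Definition unit_relation (I : set F) (x : F) (m : nat) :=
  exists q : {poly F}, [/\ (size q <= m.+1)%N, forall i, I q`_i & q.[x] = 1].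

(** Chevalley's argument. With [l <= m], the relation of [x^-1] multiplied by [x ^+ m] expresses
    [x ^+ m] through lower powers, since [1 - r_0] is a unit of [B]; substituting this into the
    relation of [x] lowers its degree. *)
Lemma unit_relations_exclusive (B I : set F) (x : F) (m l : nat) : is_local iota B I ->
  x != 0 -> unit_relation I x m -> unit_relation I x^-1 l -> False.
Proof.
move=> loc; have [N] := ubnP (m + l); elim: N x m l => // N IH x m l.
wlog lm : x m l / (l <= m)%N => [wl|].
  have [lm|/ltnW ml] := leqP l m; first exact: wl.
  move=> lt x0 h1 h2; apply: (wl x^-1 l m) => //; rewrite ?invrK ?invr_eq0 //.
  by rewrite addnC.
rewrite ltnS => lt x0 [q [sq Iq q1]] [r [sr Ir r1]].
have [B1 Binc I0] : [/\ B 1, I `<=` B & I 0].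
  split; first by rewrite -(rmorph1 iota); exact: (lc_K loc).
    exact: (lc_IB loc).
  by rewrite -(subrr q`_0); apply: (lc_IS loc).
have nI : ~ I (1 - r`_0).
  move=> h; apply: (lc_I1 loc); have -> : 1 = (1 - r`_0) - (0 - r`_0).
    by rewrite sub0r opprK subrK.
  by apply: (lc_IS loc) => //; apply: (lc_IS loc).
have u0 : 1 - r`_0 != 0 by apply/eqP => e; apply: nI; rewrite e.
set u := (1 - r`_0)^-1.
have Bu : B u by apply: (lc_V loc) => //; apply: (lc_B loc) => //; exact: Binc.
have [m0|m0] := posnP m.
  apply: (lc_I1 loc); rewrite -q1.
  have -> : q = (q`_0)%:P by apply: size1_polyC; rewrite m0 in sq.
  by rewrite hornerC.
(* [x ^+ m] is [h.[x]], with [h] of degree less than [m] and coefficients in [I]. *)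
pose h : {poly F} := \poly_(i < m) (u * r`_(m - i)).
have Ih i : I h`_i.
  by rewrite coef_poly; case: ifP => // _; apply: (lc_IM loc).
have hx : h.[x] = x ^+ m.
  have : r.[x^-1] = r`_0 + \sum_(1 <= k < m.+1) r`_k * x^-1 ^+ k.
    rewrite (@horner_coef_wide _ m.+1); last by apply: leq_trans sr _.
    by rewrite big_ord_recl expr0 mulr1 big_add1 big_mkord.
  rewrite r1 => e1.
  have e : 1 - r`_0 = \sum_(1 <= k < m.+1) r`_k * x^-1 ^+ k by rewrite e1 addrC addKr.
  rewrite horner_poly; transitivity (u * x ^+ m * (1 - r`_0)); last first.
    by rewrite mulrAC mulVf // mul1r.
  rewrite e big_distrr /= big_add1 big_mkord (reindex_inj rev_ord_inj) /=.
  apply: eq_bigr => i _; rewrite subKn; last exact: ltn_ord.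
  have -> : x ^+ m = x ^+ (m - i.+1) * x ^+ i.+1 by rewrite -exprD subnK.
  rewrite exprVn [r`__ * _ ^-1]mulrC mulrA -[u * _ * _]mulrA mulfK ?expf_neq0 //.
  by rewrite mulrAC.
pose q' := \poly_(i < m) q`_i + q`_m *: h.
have : unit_relation I x m.-1.
  exists q'; split.
  - rewrite prednK //; apply: leq_trans (size_polyD _ _) _; rewrite geq_max size_poly.
    by apply: leq_trans (size_scale_leq _ _) (size_poly _ _).
  - move=> i; rewrite coefD coefZ coef_poly -[_ * _]opprK -[- (_ * _)]add0r.
    apply: (lc_IS loc); first by case: ifP.
    apply: (lc_IS loc) => //; apply: (lc_IM loc) => //; exact: Binc.
  - rewrite hornerD hornerZ hx horner_poly -q1 (@horner_coef_wide _ m.+1) //.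
    by rewrite big_ord_recr.
move=> /(IH x m.-1 l); apply => //; last by exists r.
by rewrite -addSn prednK.
Qed.

Lemma local_maximal_valuation (B I : set F) : is_local iota B I ->
  (forall B' I', is_local iota B' I' -> B `<=` B' -> I `<=` I' -> B' `<=` B) ->
  forall x, B x \/ B x^-1.
Proof.
move=> loc max x; have ext y : (exists q : {poly F}, (forall i, I q`_i) /\ q.[y] = 1) \/ B y.
  have [|[B' [I' [loc' hB hI B'y]]]] := local_extend y loc; first by left.
  by right; apply: (max _ _ loc').
have [x0|x0] := eqVneq x 0; first by left; rewrite x0 -(rmorph0 iota); exact: (lc_K loc).
have [[q [Iq q1]]|] := ext x; last by left.
have [[r [Ir r1]]|] := ext x^-1; last by right.
exfalso; apply: (@unit_relations_exclusive B I x (size q) (size r) loc x0).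
  by exists q; split=> //; rewrite leqnSn.
by exists r; split=> //; rewrite leqnSn.
Qed.

(** Here [phi] is a [K]-point whose kernel contains that of [ev]. A maximal pair above the
    localization at [phi] is a valuation ring, and its residue field is algebraic because this is
    part of what Zorn's lemma is applied to. *)
Lemma place_extension (A : comNzRingType) (ev : {rmorphism A -> F})
    (phi : {rmorphism A -> K}) (j0 : {rmorphism K -> A}) :
  (forall c, ev (j0 c) = iota c) -> (forall c, phi (j0 c) = c) ->
  (forall a, ev a = 0 -> phi a = 0) ->
  exists (O : comUnitRingType) (inc : {rmorphism O -> F}) (k : fieldType)
    (pi : {rmorphism O -> k}) (f : {rmorphism K -> k}),
    [/\ injective inc, forall x, (exists y, inc y = x) \/ (exists y, inc y = x^-1),
      forall a, exists y, inc y = ev a /\ pi y = f (phi a) &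
      forall y, algebraicOver f y].
Proof.
move=> evj phij ker.
have [|B0 [I0 [loc0 B0ev I0ev]]] := local_of_place evj ker.
  move=> y; have [p p0 rp] := algebraic_id (idfun : {rmorphism K -> K}) y.
  by exists p => //; rewrite (eq_map_poly (g := idfun)).
have [B [I [loc hB hI max]]] := maximal_local loc0.
have val := local_maximal_valuation loc max.
have [O [inc [k [pi [j [[inj im] hj spi kpi alg]]]]]] := local_residue loc.
exists O, inc, k, pi, (pi \o j); split=> //.
  by move=> x; have [/im|/im] := val x; [left|right].
move=> a; have [y ey] := proj1 (im _) (hB _ (B0ev a)); exists y; split=> //.
apply/eqP; rewrite /= -subr_eq0 -rmorphB; apply/eqP/kpi; rewrite rmorphB ey hj -evj -rmorphB.
by apply/hI/I0ev; rewrite rmorphB phij subrr.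
Qed.

End Place.

(** * Towers of separable extensions *)

(* Finite extensions of [K] obtained by successively adjoining roots of
   separable polynomials; [E] is [L[X]/(p)]. *)
Inductive tower (K : fieldType) : forall L : fieldType, {rmorphism K -> L} -> Prop :=
| TowerBase : tower (idfun : {rmorphism K -> K})
| TowerStep (L E : fieldType) (f : {rmorphism K -> L}) (p : {poly L})
    (pi : {rmorphism {poly L} -> E}) (i : {rmorphism L -> E}) :
    tower f -> separable_poly p ->
    (forall y, exists x, pi x = y) -> (forall x, pi x = 0 <-> p %| x) ->
    (forall c, i c = pi c%:P) -> tower (i \o f).

Lemma irreducible_root (L k : fieldType) (j : {rmorphism L -> k}) (x : k)
    (p : {poly L}) : p != 0 -> root (map_poly j p) x ->
  exists h, [/\ irreducible_poly h, h %| p & root (map_poly j h) x].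
Proof.
have [N] := ubnP (size p); elim: N p => // N IH p; rewrite ltnS => le p0 rp.
have sp : size p != 1%N.
  apply/negP => /size_poly1P[c c0 e]; move: rp.
  by rewrite e map_polyC rootC fmorph_eq0 (negPf c0).
have [h irr hp] := irreducible_factor sp; have [s es] := dvdpP _ _ hp.
move: rp; rewrite es rmorphM rootM => /orP[rs|rh]; last by exists h; split=> //; exact: dvdp_mull.
have s0 : s != 0 by apply: contraNneq p0 => e; rewrite es e mul0r.
have lt : (size s < N)%N.
  apply: leq_trans le; rewrite es size_mul ?(irredp_neq0 irr) //.
  have [h1 _] := irr; move: h1; case: (size h) => [|[|m]] // _.
  by rewrite !addnS /= ltnS leq_addr.
have [t [irrt ts rt]] := IH s lt s0 rs.
by exists t; split=> //; exact: dvdp_mulr.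
Qed.

(** The elements are adjoined one by one. Perfectness is applied to an irreducible polynomial over
    [K] with root [x]; its factors over [L] inherit separability. *)
Lemma tower_embedding (K k : fieldType) (fk : {rmorphism K -> k}) (xs : seq k) :
  perfect_field K -> (forall y, algebraicOver fk y) ->
  exists (L : fieldType) (f : {rmorphism K -> L}) (j : {rmorphism L -> k}),
    [/\ tower f, forall c, j (f c) = fk c &
        forall x, x \in xs -> exists y, j y = x].
Proof.
move=> hK alg; elim: xs => [|x xs [L [f [j [tf jf hxs]]]]].
  by exists K, idfun, fk; split=> //; exact: TowerBase.
have [p p0 rp] := alg x; have [m [irrm _ rm]] := irreducible_root p0 rp.
have rmj : root (map_poly j (map_poly f m)) x.
  by rewrite -map_poly_comp (eq_map_poly (g := fk)).
have [|h [irrh hm rh]] := irreducible_root _ rmj.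
  by rewrite map_poly_eq0 irredp_neq0.
have sh : separable_poly h.
  by apply: dvdp_separable hm _; rewrite separable_map; exact: hK.
have [E [pi [spi kpi]]] := simple_extension irrh.
pose ev : {rmorphism {poly L} -> k} := horner_eval x \o map_poly j.
have [|j' ej'] := @rmorphism_factor _ _ _ pi ev spi.
  move=> q /kpi /dvdpP[s ->]; rewrite rmorphM /= [X in _ * X](_ : _ = 0) ?mulr0 //.
  exact/rootP.
exists E, ((pi \o polyC) \o f), j'; split.
- by apply: TowerStep tf sh spi kpi _.
- by move=> c /=; rewrite ej' /= /horner_eval map_polyC hornerC /= jf.
move=> y; rewrite inE => /orP[/eqP->|/hxs[z ez]].
  by exists (pi 'X); rewrite ej' /= /horner_eval map_polyX hornerX.
by exists (pi z%:P); rewrite ej' /= /horner_eval map_polyC hornerC.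
Qed.

(* [e] is a polynomial expression [q] in the class of ['X], of degree less than
   that of [p].  If it is not constant, some irreducible factor [h] of [p] over
   [E] does not divide [q - e], and sending the class of ['X] to a root of [h]
   moves [e]. *)
Lemma tower_step_descent (K L E : fieldType) (f : {rmorphism K -> L})
    (p : {poly L}) (pi : {rmorphism {poly L} -> E}) (i : {rmorphism L -> E}) (e : E) :
  tower f -> separable_poly p ->
  (forall y, exists x, pi x = y) -> (forall x, pi x = 0 <-> p %| x) ->
  (forall c, i c = pi c%:P) ->
  (forall (W : fieldType) (i1 i2 : {rmorphism E -> W}), tower (i1 \o (i \o f)) ->
     (forall c, i1 (i c) = i2 (i c)) -> i1 e = i2 e) ->
  exists c, e = i c.
Proof.
move=> tf sp spi kpi hi hW; have tE : tower (i \o f) by apply: TowerStep tf sp spi kpi hi.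
have p0 : p != 0 by exact: separable_poly_neq0.
have [q [eq sq]] : exists q, pi q = e /\ (size q < size p)%N.
  have [q0 eq0] := spi e; exists (q0 %% p); split; last by rewrite ltn_modp.
  rewrite -eq0; apply/eqP; rewrite -subr_eq0 -rmorphB; apply/eqP/kpi.
  by rewrite {2}(divp_eq q0 p) opprD addrCA subrr addr0 dvdpNr dvdp_mull.
have [sq1|sq1] := leqP (size q) 1.
  by exists q`_0; rewrite -eq hi -size1_polyC.
pose D := map_poly i q - e%:P; pose p' := map_poly i p.
have sp' : separable_poly p' by rewrite separable_map.
have sD : size D = size q.
  rewrite /D size_polyDl size_map_poly // size_polyN.
  exact: leq_ltn_trans (size_polyC_leq1 _) sq1.
have nd : ~~ (p' %| D).
  apply/negP => /dvdp_leq; rewrite -size_poly_eq0 sD size_map_poly leqNgt sq => h.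
  by have := h; case: (size q) sq1 => // m _ /(_ isT).
pose g := gcdp p' D; pose c := p' %/ g.
have ec : p' = c * g by rewrite divpK // dvdp_gcdl.
have sc : size c != 1%N.
  apply/negP => /size_poly1P[a a0 ea]; case/negP: nd.
  by rewrite ec ea mul_polyC dvdpZl // dvdp_gcdr.
have [h irrh hc] := irreducible_factor sc.
have hp : h %| p' by rewrite ec dvdp_mulr.
(* Otherwise [h] divides both [c] and the gcd, so its square divides the separable polynomial
   [p']. *)
have nhD : ~~ (h %| D).
  apply/negP => hD; have hg : h %| g by rewrite dvdp_gcd hp.
  have : h * h %| p' by rewrite ec dvdp_mul.
  have [h1 _] := irrh; rewrite -expr2 => h2.
  have {}h1 : size h != 1%N by rewrite neq_ltn h1 orbT.
  by have := separable_nosquare sp' (isT : (1 < 2)%N) h1; rewrite h2.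
have sh : separable_poly h by exact: dvdp_separable hp sp'.
have [W [pi2 [spi2 kpi2]]] := simple_extension irrh.
have [|i2 ei2] := @rmorphism_factor _ _ _ pi (pi2 \o map_poly i) spi.
  move=> s /kpi /dvdpP[t ->]; apply/kpi2; rewrite rmorphM /=.
  exact: dvdp_mull.
exfalso; case/negP: nhD; apply/kpi2; rewrite /D rmorphB.
(* If the two embeddings agree on [e], then [q - e] vanishes at the adjoined root of [h], against
   the choice of [h]. *)
have -> : pi2 e%:P = pi2 (map_poly i q); last by rewrite subrr.
transitivity (i2 (pi q)); last by rewrite ei2.
rewrite eq; apply: (hW W (pi2 \o polyC) i2).
  exact: TowerStep tE sh spi2 kpi2 _.
by move=> a; rewrite [in RHS]hi ei2 /= map_polyC.
Qed.

(** * Weighted flags of minimal norm *)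

Section Feasible.
Variables (R : realType) (d : nat) (n : 'I_d -> nat) (alpha : 'I_d -> R) (r : R).
Implicit Types a b c : forall i : 'I_d, 'I_(n i) -> R.

Definition cost a : R := \sum_(i < d) alpha i * \sum_l a i l.

Definition sqnorm a : R := \sum_(i < d) \sum_l a i l ^+ 2.

(** For [r > 0] this reads [1 + cost a <= r * weight a j] on the support. The strict homogeneous
    inequality is normalized by scaling, so that the condition becomes closed and convex in [a] and
    excludes the zero weight when [v] is nonzero. *)
Definition feasible (L : fieldType) (v : tensor L n) (g : forall i, 'M[L]_(n i)) a :=
  [/\ in_G g, forall i l, 0 <= a i l &
    forall j, tensor_act g v j != 0 -> (1 + cost a) / r <= weight a j].

Definition permute (s : forall i, 'S_(n i)) a : forall i : 'I_d, 'I_(n i) -> R :=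
  fun i l => a i (s i l).

Lemma cost_permute s a : cost (permute s a) = cost a.
Proof.
apply: eq_bigr => i _; congr (_ * _).
by rewrite [RHS](reindex_inj (@perm_inj _ (s i))).
Qed.

Lemma sqnorm_permute s a : sqnorm (permute s a) = sqnorm a.
Proof. by apply: eq_bigr => i _; rewrite [RHS](reindex_inj (@perm_inj _ (s i))). Qed.

Lemma eq_feasible (L : fieldType) (v : tensor L n) g h a :
  (forall i, g i = h i) -> feasible v g a -> feasible v h a.
Proof.
move=> e [ug ha hg]; split=> // [i|j]; first by rewrite -e.
by rewrite -(eq_tensor_act v e); exact: hg.
Qed.

Lemma feasible_mul (L : fieldType) (v : tensor L n) (M g : forall i, 'M[L]_(n i)) a b :
  in_G M -> (forall i l, 0 <= b i l) -> cost b = cost a ->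
  (forall i k l, M i k l != 0 -> a i l <= b i k) ->
  feasible v g a -> feasible v (fun i => M i *m g i) b.
Proof.
move=> uM hb cb hM [ug ha hg]; split=> // [i|j].
  by rewrite unitmx_mul uM ug.
by rewrite tensor_actM cb; apply: weight_support hM hg _.
Qed.

Lemma feasible_permute (L : fieldType) (v : tensor L n) (s : forall i, 'S_(n i)) g a :
  feasible v g a -> feasible v (fun i => perm_mx (s i) *m g i) (permute s a).
Proof.
move=> fg; have [ug ha hg] := fg.
apply: feasible_mul fg => [i|i l||i k l]; first exact: unitmx_perm.
- exact: ha.
- exact: cost_permute.
by rewrite !mxE; case: (s i k =P l) => [<-|_] //; rewrite eqxx.
Qed.

Lemma sort_weights (m : nat) (a : 'I_m -> R) :
  exists s : 'S_m, {homo (fun k => a (s k)) : k l / (k <= l)%N >-> l <= k}.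
Proof.
pose t := [tuple a k | k < m].
have srt : sorted >=%R (sort >=%R t) by apply: sort_sorted => x y; exact: le_total.
have /tuple_permP[s es] : perm_eq (sort_tuple >=%R t) t by rewrite perm_sort.
exists s => k l kl.
have ek (k' : 'I_m) : a (s k') = nth 0 (sort >=%R t) k'.
  by rewrite -[sort _ _]/(tval (sort_tuple >=%R t)) es -tnth_nth !tnth_mktuple.
rewrite !ek; apply: (sorted_leq_nth (leT := >=%R)) => //.
- by move=> x y z h1 h2; exact: le_trans h2 h1.
- by move=> x; exact: lexx.
- by rewrite inE size_sort size_tuple.
- by rewrite inE size_sort size_tuple.
Qed.

Lemma feasible_sort (L : fieldType) (v : tensor L n) g a : feasible v g a ->
  exists h b, [/\ feasible v h b, sqnorm b = sqnorm a &
    forall i, {homo b i : k l / (k <= l)%N >-> l <= k}].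
Proof.
move=> fg; have [s hs] := fin_all_exists (fun i => sort_weights (a i)).
exists (fun i => perm_mx (s i) *m g i), (permute s a); split=> //.
  exact: feasible_permute.
exact: sqnorm_permute.
Qed.

(** For a fixed [g] the constraints are affine in the weight. *)
Lemma feasible_midpoint (L : fieldType) (v : tensor L n) g a b :
  feasible v g a -> feasible v g b ->
  feasible v g (fun i l => (a i l + b i l) / 2%:R).
Proof.
move=> [ug ha hga] [_ hb hgb]; split=> // [i l|j nz].
  by rewrite divr_ge0 ?addr_ge0 ?ler0n.
have -> : cost (fun i l => (a i l + b i l) / 2%:R) = (cost a + cost b) / 2%:R.
  rewrite /cost -big_split big_distrl; apply: eq_bigr => i _ /=.
  by rewrite -mulrDr -big_split /= -mulrA; congr (_ * _); rewrite big_distrl.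
have -> : weight (fun i l => (a i l + b i l) / 2%:R) j = (weight a j + weight b j) / 2%:R.
  by rewrite /weight -big_split big_distrl.
rewrite ler_pdivlMr ?ltr0n // (_ : _ / r * _ = (1 + cost a) / r + (1 + cost b) / r).
  exact: lerD (hga j nz) (hgb j nz).
by rewrite -mulrDl mulrAC; congr (_ / r); field.
Qed.

(** Parallelogram identity: the squared distance [D] is both nonnegative and at most zero. *)
Lemma sqnorm_midpoint a b : sqnorm a = sqnorm b ->
  sqnorm a <= sqnorm (fun i l => (a i l + b i l) / 2%:R) -> forall i l, a i l = b i l.
Proof.
move=> eab le i l.
pose D := \sum_(i < d) \sum_(l < n i) (a i l - b i l) ^+ 2.
have eD : D = 2%:R * sqnorm a + 2%:R * sqnorm b -
    4%:R * sqnorm (fun i l => (a i l + b i l) / 2%:R).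
  rewrite /D /sqnorm !big_distrr -big_split -sumrB; apply: eq_bigr => k _ /=.
  rewrite !big_distrr -big_split -sumrB; apply: eq_bigr => m _ /=.
  by field.
have D0 : D = 0.
  apply/eqP; rewrite eq_le; apply/andP; split; last first.
    by apply: sumr_ge0 => k _; apply: sumr_ge0 => m _; exact: sqr_ge0.
  rewrite eD -eab -mulrDl -natrD subr_le0; apply: ler_wpM2l => //.
move/eqP: D0; rewrite psumr_eq0 => [|k _]; last first.
  by apply: sumr_ge0 => m _; exact: sqr_ge0.
move/allP/(_ i (mem_index_enum _)); rewrite /= psumr_eq0 => [|m _]; last exact: sqr_ge0.
move/allP/(_ l (mem_index_enum _)); rewrite /= sqrf_eq0 subr_eq0.
by move/eqP.
Qed.

(* After a Bruhat decomposition of [g h^-1], both weighted flags are split by a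
   common basis; the midpoint of the two weights is feasible as well, so by
   minimality the weights agree on that basis. *)
Lemma feasible_rigid (L : fieldType) (v : tensor L n) g h a :
  feasible v g a -> feasible v h a ->
  (forall i, {homo a i : k l / (k <= l)%N >-> l <= k}) ->
  (forall f c, feasible v f c -> sqnorm a <= sqnorm c) ->
  forall i, pattern (fun k l => a i l <= a i k) (g i *m invmx (h i)).
Proof.
move=> fg fh srt min; have [ug ha _] := fg; have [uh _ _] := fh.
have [b1 {}/fin_all_exists[b2 {}/fin_all_exists[s hs]]] := fin_all_exists (fun i =>
  bruhat_decomposition (etrans (unitmx_mul (g i) (invmx (h i)))
    (etrans (congr1 (andb _) (unitmx_inv _)) (introT andP (conj (ug i) (uh i)))))).
have ub1 i : b1 i \in unitmx by case: (hs i).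
have ub2 i : b2 i \in unitmx by case: (hs i).
have pB i (b : 'M[L]_(n i)) : pattern (@ord_le _) b -> pattern (fun k l => a i l <= a i k) b.
  by move=> hb k l /hb /srt.
have rP i : reflexive (fun k l : 'I_(n i) => a i l <= a i k) by move=> k; exact: lexx.
have tP i : transitive (fun k l : 'I_(n i) => a i l <= a i k).
  by move=> x y z h1 h2; exact: le_trans h2 h1.
have p1 i : pattern (fun k l => a i l <= a i k) (b1 i) by apply: pB; case: (hs i).
have p2 i : pattern (fun k l => a i l <= a i k) (b2 i) by apply: pB; case: (hs i).
pose f i := invmx (b2 i) *m h i.
have ff : feasible v f a.
  apply: feasible_mul fh => // i; first by rewrite unitmx_inv.
  exact: pattern_inv.
(* The Bruhat relation carries the weights of [g] to the basis [f], permuted by the inverse of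
   [s]. *)
have fs : feasible v f (permute (fun i => (s i)^-1%g) a).
  have fb : feasible v (fun i => b1 i *m g i) a by apply: feasible_mul fg.
  apply: eq_feasible (feasible_permute (fun i => (s i)^-1%g) fb) => i.
  have [_ _ _ _ e] := hs i.
  have -> : b1 i *m g i = perm_mx (s i) *m f i.
    by rewrite -e -!mulmxA (mulKVmx (ub2 i)) mulVmx ?mulmx1.
  by rewrite mulmxA -perm_mxM mulVg perm_mx1 mul1mx.
have eas : forall i l, a i ((s i)^-1%g l) = a i l.
  apply: (@sqnorm_midpoint (permute (fun i => (s i)^-1%g) a)).
    exact: sqnorm_permute.
  by rewrite sqnorm_permute; apply: min (feasible_midpoint fs ff).
move=> i; have -> : g i *m invmx (h i) = invmx (b1 i) *m perm_mx (s i) *m invmx (b2 i).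
  have [_ _ _ _ <-] := hs i.
  by rewrite -!mulmxA (mulKmx (ub1 i)) mulmxV ?mulmx1 // mulmxA.
(* All three factors preserve the weight filtration: the outer ones are upper triangular for sorted
   weights, and the permutation fixes the weights by [eas]. *)
apply: patternM => //; last exact: pattern_inv.
apply: patternM => //; first exact: pattern_inv.
move=> k l; rewrite !mxE; case: (s i k =P l) => [<- _|_]; last by rewrite eqxx.
by rewrite -(eas i (s i k)) permK.
Qed.

(* The representative [u * perm_mx s] of the coset of [g] modulo the parabolic
   subgroup of [a] is unique, so it is moved by no embedding over [L]. *)
Lemma tower_descent (K L : fieldType) (f : {rmorphism K -> L}) (v : tensor K n) a :
  (forall i, {homo a i : k l / (k <= l)%N >-> l <= k}) ->
  (forall (L : fieldType) (f : {rmorphism K -> L}), tower f ->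
     forall g c, feasible (tensor_map f v) g c -> sqnorm a <= sqnorm c) ->
  tower f -> (exists g, feasible (tensor_map f v) g a) -> exists g, feasible v g a.
Proof.
move=> srt min; elim=> {L f} [|L E f p pi i tf IH sp spi kpi hi [g fg]].
  have -> : tensor_map (idfun : {rmorphism K -> K}) v = v.
    by apply/ffunP => j; rewrite ffunE.
  by [].
apply: IH; have tE : tower (i \o f) by apply: TowerStep tf sp spi kpi hi.
have rP k : reflexive (fun x y : 'I_(n k) => a k y <= a k x) by move=> x; exact: lexx.
have tP k : transitive (fun x y : 'I_(n k) => a k y <= a k x).
  by move=> x y z h1 h2; exact: le_trans h2 h1.
have [ug ha hg] := fg.
have [q {}/fin_all_exists[u {}/fin_all_exists[s hs]]] := fin_all_exists (fun k =>
  coset_representative (srt k) (ug k)).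
pose h k := u k *m perm_mx (s k).
have fh : feasible (tensor_map (i \o f) v) h a.
  have fq : feasible (tensor_map (i \o f) v) (fun k => invmx (q k) *m g k) a.
    apply: feasible_mul fg => // [k|k]; first by rewrite unitmx_inv; case: (hs k).
    by apply: pattern_inv => //; case: (hs k).
  apply: eq_feasible fq => k; have [uq _ _ _ ->] := hs k.
  by rewrite -!mulmxA mulKmx.
have uu k : u k \in unitmx.
  have [_ _ _ _ eg] := hs k; move: (ug k).
  by rewrite {1}eg !unitmx_mul => /andP[/andP[]].
have eu k x y : exists z : L, u k x y = i z.
  apply: (tower_step_descent tf sp spi kpi hi) => W i1 i2 tW e12.
  (* [v] is defined below [L], where the two embeddings agree, so both conjugates of [h] are
     feasible for the same tensor over [W]. *)
  have fmap (i' : {rmorphism E -> W}) : (forall z : L, i1 (i z) = i' (i z)) ->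
      feasible (tensor_map (i1 \o (i \o f)) v) (fun k => map_mx i' (h k)) a.
    move=> ei'; have [uh _ hh] := fh; split=> // [k'|j]; first by rewrite map_unitmx.
    have -> : tensor_map (i1 \o (i \o f)) v = tensor_map i' (tensor_map (i \o f) v).
      by apply/ffunP => j'; rewrite !ffunE /= ei'.
    by rewrite -tensor_map_act ffunE fmorph_eq0; exact: hh.
  have : pattern (fun x y => a k y <= a k x)
      (map_mx i1 (h k) *m invmx (map_mx i2 (h k))).
    exact: (feasible_rigid (fmap i1 (fun=> erefl)) (fmap i2 e12) srt (min _ _ tW)).
  (* Both conjugates have the same permutation factor, which cancels. *)
  have -> : map_mx i1 (h k) *m invmx (map_mx i2 (h k)) =
      map_mx i1 (u k) *m invmx (map_mx i2 (u k)).
    rewrite /h !map_mxM !map_perm_mx.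
    apply: (canLR (mulmxK _)); first by rewrite unitmx_mul map_unitmx uu unitmx_perm.
    by rewrite mulmxA mulmxKV ?map_unitmx.
  move=> pP; pose w := map_mx i1 (u k) *m invmx (map_mx i2 (u k)).
  pose e := (fun x y : 'I_(n k) => (x == y) || (a k x < a k y)).
  have pe (i' : {rmorphism E -> W}) : pattern e (map_mx i' (u k)).
    move=> x' y'; rewrite mxE fmorph_eq0; have [_ _ pu _ _] := hs k; exact: pu.
  have re : reflexive e by move=> ?; rewrite /e eqxx.
  have te : transitive e.
    move=> y' x' z' /orP[/eqP->//|h1] /orP[/eqP<-|h2]; rewrite /e ?h1 ?orbT //.
    by rewrite (lt_trans h1 h2) orbT.
  have pw : pattern e w.
    apply: (patternM te (pe i1)); apply: (pattern_inv re te _ (pe i2)).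
    by rewrite map_unitmx.
  (* [w] satisfies the parabolic and the opposite unipotent pattern at once, so it is diagonal; the
     unit diagonals of the two conjugates of [u] then make its diagonal entries [1]. *)
  have dw x' y' : x' != y' -> w x' y' = 0.
    move=> ne; apply/eqP/negPn/negP => nz; have := pw _ _ nz; have := pP _ _ nz.
    by rewrite /e (negPf ne) /= leNgt => /negP.
  have ew : map_mx i1 (u k) = w *m map_mx i2 (u k) by rewrite mulmxKV // map_unitmx.
  have ewk x' y' : map_mx i1 (u k) x' y' = w x' x' * map_mx i2 (u k) x' y'.
    rewrite ew mxE (bigD1 x') //= big1 ?addr0 // => z' nz.
    by rewrite dw 1?eq_sym // mul0r.
  have w1 : w x x = 1.
    have := ewk x x; rewrite !mxE; have [_ _ _ -> _] := hs k.
    by rewrite !rmorph1 mulr1.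
  by have := ewk x y; rewrite w1 mul1r !mxE.
have /boolp.choice[c hc] : forall t : {k : 'I_d & ('I_(n k) * 'I_(n k))%type},
    exists z : L, u (tag t) (tagged t).1 (tagged t).2 = i z by move=> t; exact: eu.
pose u0 k : 'M[L]_(n k) := \matrix_(x, y) c (Tagged (fun k => ('I_(n k) * 'I_(n k))%type) (x, y)).
have eu0 k : map_mx i (u0 k) = u k by apply/matrixP => x y; rewrite !mxE -hc.
have eh k : map_mx i (u0 k *m perm_mx (s k)) = h k by rewrite map_mxM map_perm_mx eu0.
have [uh _ hh] := fh.
exists (fun k => u0 k *m perm_mx (s k)); split=> // [k|j nz].
  by rewrite -(map_unitmx i) eh.
apply: hh; rewrite -(eq_tensor_act _ eh).
have -> : tensor_map (i \o f) v = tensor_map i (tensor_map f v).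
  by apply/ffunP => j'; rewrite !ffunE.
by rewrite -tensor_map_act ffunE fmorph_eq0.
Qed.

End Feasible.

(** * Existence of a weight of minimal norm *)

Lemma continuous_sum (R : realType) (T : topologicalType) (I : finType)
    (f : I -> T -> R) :
  (forall i, continuous (f i)) -> continuous (fun x => \sum_i f i x).
Proof.
move=> cf; have -> : (fun x => \sum_i f i x) = (fun x => \sum_(i <- index_enum I) f i x) by [].
elim: (index_enum I) => [|i s IH] x.
  have -> : (fun x => \sum_(i <- [::]) f i x) = cst 0.
    by apply/funext => y; rewrite big_nil.
  exact: cst_continuous.
have -> : (fun x => \sum_(i <- i :: s) f i x) = (f i \+ (fun x => \sum_(i <- s) f i x)).
  by apply/funext => y; rewrite big_cons.
by apply: cvgD; [exact: cf|exact: IH].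
Qed.

Section MinimalNorm.
Variables (R : realType) (d : nat) (n : 'I_d -> nat) (alpha : 'I_d -> R) (r : R).
Implicit Types a b c : forall i : 'I_d, 'I_(n i) -> R.

Let T : finType := {i : 'I_d & 'I_(n i)}.

(** Topology is available on row vectors; the dependent family of weights is flattened by
    enumerating the pairs [(i, l)]. *)
Definition row_weights (x : 'rV[R]_#|T|) : forall i : 'I_d, 'I_(n i) -> R :=
  fun i l => x ord0 (enum_rank (Tagged (fun i => 'I_(n i)) l : T)).
Arguments row_weights x i l : clear implicits.

Definition weights_row a : 'rV[R]_#|T| := \row_k a (tag (enum_val k)) (tagged (enum_val k)).

Lemma weights_rowK a : row_weights (weights_row a) = a.
Proof.
apply: functional_extensionality_dep => i; apply/funext => l.
by rewrite /row_weights mxE enum_rankK.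
Qed.

Lemma row_weights_continuous i l : continuous (fun x => row_weights x i l).
Proof. by move=> x; exact: coord_continuous. Qed.

Lemma cost_continuous : continuous (fun x => cost alpha (row_weights x)).
Proof.
apply: continuous_sum => i x.
apply: (@continuousM R _ (cst (alpha i)) (fun x => \sum_l row_weights x i l) x).
  exact: cst_continuous.
by apply: continuous_sum => l y; exact: row_weights_continuous.
Qed.

Lemma weight_continuous j : continuous (fun x => weight (row_weights x) j).
Proof. by apply: continuous_sum => i x; exact: row_weights_continuous. Qed.

Lemma sqnorm_continuous : continuous (fun x => sqnorm (row_weights x)).
Proof.
apply: continuous_sum => i; apply: continuous_sum => l x.
by apply: (@continuousM R _ (fun x => row_weights x i l) (fun x => row_weights x i l) x);
  exact: row_weights_continuous.
Qed.

Lemma closed_leq_continuous (U : topologicalType) (f g : U -> R) :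
  continuous f -> continuous g -> closed [set x | f x <= g x].
Proof.
move=> cf cg; have -> : [set x | f x <= g x] = (fun x => g x - f x) @^-1` [set y | 0 <= y].
  by apply/seteqP; split=> x /=; rewrite subr_ge0.
apply: closed_comp; last exact: closed_ge.
by move=> x _; apply: cvgB; [exact: cg|exact: cf].
Qed.

Lemma minimal_norm (C : set 'rV[R]_#|T|) : closed C -> C !=set0 ->
  (forall x, C x -> forall i l, 0 <= row_weights x i l) ->
  exists2 x, C x & forall y, C y -> sqnorm (row_weights x) <= sqnorm (row_weights y).
Proof.
(* The summand [1] makes [M >= 1]: a coordinate beyond [M] then has a square above the norm of [x0],
   and the coordinates of [x0] itself stay below [M] even when they are less than their squares'
   bound suggests, that is, at most [1]. *)
move=> clC [x0 Cx0] pos; pose M := 1 + sqnorm (row_weights x0).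
have sq_le a i l : a i l ^+ 2 <= sqnorm a.
  rewrite /sqnorm (bigD1 i) //= (bigD1 l) //= -addrA lerDl addr_ge0 //.
    by apply: sumr_ge0 => m _; exact: sqr_ge0.
  by apply: sumr_ge0 => k _; apply: sumr_ge0 => m _; exact: sqr_ge0.
have sq0 a : 0 <= sqnorm a.
  by apply: sumr_ge0 => k _; apply: sumr_ge0 => m _; exact: sqr_ge0.
pose A : set 'rV[R]_#|T| := [set x | forall k, `[0, M]%classic (x ord0 k)].
have cA : compact A.
  by apply: (@rV_compact _ _ (fun=> `[0, M]%classic)) => k; exact: segment_compact.
have coordE (x : 'rV[R]_#|T|) k : x ord0 k =
    row_weights x (tag (enum_val k)) (tagged (enum_val k)).
  by rewrite /row_weights; congr (x _ _); rewrite -[LHS]enum_valK; congr enum_rank; case: (enum_val k).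
have inA x : C x -> ~ A x -> sqnorm (row_weights x0) <= sqnorm (row_weights x).
  move=> Cx /existsNP[k]; rewrite /= in_itv /= coordE pos //= => /negP; rewrite -ltNge => lt.
  apply: le_trans (sq_le (row_weights x) (tag (enum_val k)) (tagged (enum_val k))).
  have M1 : 1 <= M by rewrite lerDl.
  have M0 : 0 <= M by exact: le_trans ler01 M1.
  apply: (@le_trans _ _ (M ^+ 2)); last first.
    by rewrite ler_sqr ?nnegrE ?pos //; exact: ltW.
  by apply: (@le_trans _ _ M); [rewrite lerDr|rewrite expr2 ler_peMr].
have Ax0 : A x0.
  move=> k; rewrite /= in_itv /= coordE pos //=; set y := row_weights _ _ _.
  have := sq_le (row_weights x0) (tag (enum_val k)) (tagged (enum_val k)).
  rewrite -/y /M => h; have [y1|y1] := leP y 1; first by rewrite (le_trans y1) // lerDl.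
  apply: (@le_trans _ _ (y ^+ 2)); first by rewrite expr2 ler_peMr // ?ltW // (lt_trans _ y1).
  by apply: le_trans h _; rewrite lerDr.
have [|||x /set_mem[Ax Cx] xmin] := @compact_EVT_min _ R (fun x => sqnorm (row_weights x)) (A `&` C).
- by exists x0.
- exact: compact_closedI.
- by apply: continuous_subspaceT; exact: sqnorm_continuous.
exists x => // y Cy; have [Ay|nAy] := pselect (A y); first by apply: xmin; exact/mem_set.
by apply: le_trans (inA _ Cy nAy); apply: xmin; exact/mem_set.
Qed.

(** The extensions [L] and the matrices [g] range over an infinite family, but they constrain the
    weight only through the support of the transformed tensor, one of finitely many subsets of
    [mindex n]. The norm is thus minimized over a finite union of closed polyhedra. *)
Lemma minimal_feasible (K : fieldType) (v : tensor K n) :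
  (exists (L : fieldType) (f : {rmorphism K -> L}), tower f /\
     exists g c, feasible alpha r (tensor_map f v) g c) ->
  exists (L : fieldType) (f : {rmorphism K -> L}), tower f /\
    exists g a, feasible alpha r (tensor_map f v) g a /\
      forall (E : fieldType) (f' : {rmorphism K -> E}), tower f' ->
      forall h c, feasible alpha r (tensor_map f' v) h c -> sqnorm a <= sqnorm c.
Proof.
move=> [L0 [f0 [t0 [g0 [c0 feas0]]]]].
pose CS (S : {set mindex n}) : set 'rV[R]_#|T| := [set x |
  (forall t : T, 0 <= row_weights x (tag t) (tagged t)) /\
  (forall j, j \in S -> (1 + cost alpha (row_weights x)) / r <= weight (row_weights x) j)].
pose SS : set {set mindex n} := [set S | exists (L : fieldType) (f : {rmorphism K -> L}) g,
  [/\ tower f, in_G g & S = [set j | tensor_act g (tensor_map f v) j != 0]%SET]].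
pose C := \bigcup_(S in SS) CS S.
have feasC (L : fieldType) (f : {rmorphism K -> L}) g c : tower f ->
    feasible alpha r (tensor_map f v) g c -> C (weights_row c).
  move=> tf [ug hc hg]; exists [set j | tensor_act g (tensor_map f v) j != 0]%SET.
    by exists L, f, g.
  by split=> [t|j]; rewrite weights_rowK //= inE => /hg.
have [||x [S [L [f [g [tf ug eS]]]] [hx hS]] xmin] := @minimal_norm C _ (ex_intro _ _ (feasC _ _ _ _ t0 feas0)).
- apply: closed_bigcup => [|S _]; first exact: finite_finset.
  have -> : CS S = (\bigcap_(t in [set: T]) [set x | cst 0 x <= row_weights x (tag t) (tagged t)]) `&`
      \bigcap_(j in [set` S]) [set x | (1 + cost alpha (row_weights x)) / r <= weight (row_weights x) j].
    apply/seteqP; split=> x /= [h1 h2]; split=> //; first by move=> t _; apply: h1.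
    by move=> t; exact: h1.
  apply: closedI; apply: closed_bigI => t _; apply: closed_leq_continuous.
  - by move=> x; exact: cst_continuous.
  - exact: row_weights_continuous.
  - move=> x; apply: (@continuousM R _ (fun x => 1 + cost alpha (row_weights x)) (cst r^-1) x).
      apply: (@continuousD R R _ (cst 1) (fun x => cost alpha (row_weights x)) x).
        exact: cst_continuous.
      exact: cost_continuous.
    exact: cst_continuous.
  - exact: weight_continuous.
- by move=> x [S _ [hx _]] i l; exact: (hx (Tagged (fun i => 'I_(n i)) l)).
exists L, f; split=> //; exists g, (row_weights x); split.
  split=> // [i l|j nz]; first exact: (hx (Tagged (fun i => 'I_(n i)) l)).
  by apply: hS; rewrite eS inE.
move=> E f' tf' h c fh; rewrite -(weights_rowK c); apply: xmin.
exact: feasC tf' fh.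
Qed.

End MinimalNorm.

(** * Closure points of a stratum *)

Lemma tower_feasible (R : realType) (d : nat) (n : 'I_d -> nat) (alpha : 'I_d -> R)
    (r : R) (K : fieldType) (v : tensor K n) :
  (exists (L : fieldType) (f : {rmorphism K -> L}), tower f /\
     exists g c, feasible alpha r (tensor_map f v) g c) ->
  exists g c, feasible alpha r v g c.
Proof.
case/minimal_feasible=> L [f [tf [g [a [fg min]]]]].
have [h [b [fh eb srt]]] := feasible_sort fg.
have [|g' fg'] := tower_descent srt _ tf (ex_intro _ h fh); last by exists g', b.
by move=> E f' tf' h' c fc; rewrite eb; apply: min fc.
Qed.

Section ValuationRing.
Variables (O : comUnitRingType) (F : fieldType) (inc : {rmorphism O -> F}).
Hypothesis inc_inj : injective inc.
Hypothesis val : forall x : F, (exists y, inc y = x) \/ (exists y, inc y = x^-1).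

Lemma valuation_chain (x y : O) : (exists c, y = c * x) \/ (exists c, x = c * y).
Proof.
have inc0 z : inc z = 0 -> z = 0 by move=> e; apply: inc_inj; rewrite e rmorph0.
have [->|x0] := eqVneq x 0; first by right; exists 0; rewrite mul0r.
have [->|y0] := eqVneq y 0; first by left; exists 0; rewrite mul0r.
have ix : inc x != 0 by apply: contra_neq x0 => /inc0.
have iy : inc y != 0 by apply: contra_neq y0 => /inc0.
have [[c ec]|[c ec]] := val (inc x / inc y).
  by right; exists c; apply: inc_inj; rewrite rmorphM ec mulfVK.
by left; exists c; apply: inc_inj; rewrite rmorphM ec invf_div mulfVK.
Qed.

Lemma valuation_denominator (T : finType) (x : T -> F) :
  exists s, inc s != 0 /\ forall t, exists y, inc y = inc s * x t.
Proof.
suff [s [s0 hs]] : exists s, inc s != 0 /\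
    forall t, t \in enum T -> exists y, inc y = inc s * x t.
  by exists s; split=> // t; apply: hs; rewrite mem_enum.
elim: (enum T) => [|t l [s [s0 hs]]]; first by exists 1; rewrite rmorph1 oner_eq0.
have [[y ey]|[y ey]] := val (x t).
  exists s; split=> // t'; rewrite inE => /orP[/eqP->|/hs//].
  by exists (s * y); rewrite rmorphM ey.
have [x0|x0] := eqVneq (x t) 0.
  exists s; split=> // t'; rewrite inE => /orP[/eqP->|/hs//].
  by exists 0; rewrite x0 mulr0 rmorph0.
exists (s * y); split=> [|t']; first by rewrite rmorphM mulf_neq0 // ey invr_eq0.
rewrite inE => /orP[/eqP->|/hs[z ez]]; rewrite rmorphM ?ey.
  by exists s; rewrite mulfVK.
by exists (y * z); rewrite rmorphM ez ey mulrCA mulrA.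
Qed.

(** Scaling by a common denominator creates or removes no zero entry, so it suffices to
    triangularize over [O]. *)
Lemma valuation_iwasawa (n : nat) (A : 'M[F]_n) :
  exists2 k, k \in unitmx & pattern (@ord_le n) (map_mx inc k *m A).
Proof.
have [s [s0 hs]] := valuation_denominator (fun ij : 'I_n * 'I_n => A ij.1 ij.2).
have [c hc] := boolp.choice hs.
pose B := \matrix_(i, j) c (i, j).
have eB : map_mx inc B = inc s *: A by apply/matrixP => i j; rewrite !mxE hc.
have [k uk hk] := chain_triangular valuation_chain B.
exists k => // i j; apply: contraR; rewrite /ord_le -ltnNge => lt.
have : (map_mx inc k *m (inc s *: A)) i j = 0.
  by rewrite -eB -map_mxM mxE hk // rmorph0.
by rewrite -scalemxAr mxE => /eqP; rewrite mulf_eq0 (negPf s0).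
Qed.

End ValuationRing.

Section GenericPoint.
Variables (K : fieldType) (d : nat) (n : 'I_d -> nat) (S : {set mindex n}).

Let T : finType := ({i : 'I_d & ('I_(n i) * 'I_(n i))%type} + mindex n)%type.

Let X (t : T) : mpoly #|T| K := mpolyX K (mnm1 (enum_rank t)).

Definition generic_mx (i : 'I_d) : 'M[mpoly #|T| K]_(n i) :=
  \matrix_(k, l) X (inl (Tagged (fun i => ('I_(n i) * 'I_(n i))%type) (k, l))).

Definition generic_tensor : tensor (mpoly #|T| K) n :=
  [ffun j : mindex n => if j \in S then X (inr j) else 0].

(** Relations satisfied by the generic point therefore hold on the whole stratum, which allows a
    place to be centered at a point of its closure. *)
Lemma generic_specialize (g : forall i : 'I_d, 'M[K]_(n i)) (z : tensor K n) :
  (forall j, j \notin S -> z j = 0) ->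
  exists x : 'I_#|T| -> K,
    tensor_map (meval x) (tensor_act generic_mx generic_tensor) = tensor_act g z.
Proof.
move=> hz; pose x (t : T) : K := match t with
  | inl u => g (tag u) (tagged u).1 (tagged u).2 | inr j => z j end.
exists (fun k => x (enum_val k)).
rewrite tensor_map_act (eq_tensor_act _ (h := g)); last first.
  by move=> i; apply/matrixP => k l; rewrite !mxE /= /X mevalXU enum_rankK.
congr tensor_act; apply/ffunP => j; rewrite !ffunE.
by case: ifPn => [_|/hz ->]; rewrite ?rmorph0 //= /X mevalXU enum_rankK.
Qed.

(* Evaluate the generic point of [G * Z_S] at a place centered at [v], after
   making its [G]-component integral by the Iwasawa decomposition. *)
Lemma closure_residue_point (v : tensor K n) :
  (forall j k : mindex n, j \in S -> (forall i, k i <= j i)%N -> k \in S) ->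
  (forall p : mpoly #|mindex n| K,
     (forall g (z : tensor K n), in_G g -> (forall j, j \notin S -> z j = 0) ->
        meval (fun i => tensor_act g z (enum_val i) : K) p = 0) ->
     meval (fun i => v (enum_val i) : K) p = 0) ->
  exists (k : fieldType) (f : {rmorphism K -> k}) (g : forall i : 'I_d, 'M[k]_(n i)),
    [/\ forall y, algebraicOver f y, in_G g &
        forall j, tensor_act g (tensor_map f v) j != 0 -> j \in S].
Proof.
move=> down hv; set M := mpoly #|T| K.
pose F : fieldType := {fraction M}.
pose frac : {rmorphism M -> F} := @FracField.tofrac M.
pose iota : {rmorphism K -> F} := frac \o (@mpolyC #|T| K).
pose w := tensor_act generic_mx generic_tensor.
pose sub : {rmorphism mpoly #|mindex n| K -> M} :=
  comp_mpoly [tuple w (enum_val k) | k < #|mindex n|].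
pose ev : {rmorphism mpoly #|mindex n| K -> F} := frac \o sub.
pose phi : {rmorphism mpoly #|mindex n| K -> K} := meval (fun i => v (enum_val i) : K).
pose j0 : {rmorphism K -> mpoly #|mindex n| K} := @mpolyC #|mindex n| K.
have [|||O [inc [k [pi [f [inj val lift alg]]]]]] := @place_extension K F iota _ ev phi j0.
- by move=> c; rewrite /= comp_mpolyC.
- by move=> c; rewrite /= mevalC.
- move=> p /= p0; apply: hv => g z _ hz; have [x hx] := generic_specialize g hz.
  have sub0 : sub p = 0 by apply/eqP; rewrite -tofrac_eq0; exact/eqP.
  rewrite -(meval0 x) -[X in _ = meval x X]sub0 /= comp_mpoly_meval; apply: meval_eq => i.
  by rewrite tnth_mktuple -hx ffunE.
(* The coordinates of the generic point are integral at the place, with the coordinates of [v] as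
   residues. *)
have /boolp.choice[y hy] (j : mindex n) : exists y, inc y = frac (w j) /\ pi y = f (v j).
  have [y [y1 y2]] := lift (mpolyX K (mnm1 (enum_rank j))); exists y.
  rewrite y1 y2 /= mevalXU enum_rankK comp_mpolyXU; split=> //.
  by rewrite -tnth_nth tnth_mktuple enum_rankK.
have hex i : exists c : 'M[O]_(n i), c \in unitmx /\
    pattern (@ord_le _) (map_mx inc c *m map_mx frac (generic_mx i)).
  by have [c uc hc] := valuation_iwasawa inj val (map_mx frac (generic_mx i)); exists c.
have [c hc] := fin_all_exists hex.
exists k, f, (fun i => map_mx pi (c i)); split=> // [i|j].
  by have [uc _] := hc i; rewrite unitmxE det_map_mx rmorph_unit // -unitmxE.
pose yt : tensor O n := [ffun j => y j].
have -> : tensor_map f v = tensor_map pi yt.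
  by apply/ffunP => l; rewrite !ffunE; have [_ ->] := hy l.
rewrite -tensor_map_act ffunE => nz.
have : tensor_map inc (tensor_act c yt) j != 0.
  rewrite ffunE; apply: contra_neq nz => e; have -> : tensor_act c yt j = 0.
    by apply: inj; rewrite e rmorph0.
  by rewrite rmorph0.
(* Over [F], the integral tensor is an upper triangular element applied to a tensor supported in
   [S]; upper triangular matrices only lower indices, and [S] is closed under this. *)
have -> : tensor_map inc (tensor_act c yt) =
    tensor_act (fun i => map_mx inc (c i) *m map_mx frac (generic_mx i))
      (tensor_map frac generic_tensor).
  rewrite tensor_map_act tensor_actM; congr (tensor_act _ _); rewrite -tensor_map_act.
  by apply/ffunP => l; rewrite !ffunE; have [-> _] := hy l; rewrite /w ffunE.
move=> /tensor_act_support[l [zl hl]]; apply: (down l); last first.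
  by move=> i; have [_ /(_ _ _ (hl i))] := hc i.
by move: zl; rewrite !ffunE; case: ifP => // _; rewrite rmorph0 eqxx.
Qed.

End GenericPoint.

(** * Power series and the stable rank *)

Section PowerSeries.
Variable K : fieldType.
Implicit Types p q u : powerseries K.

Lemma ps_coefM p q k : (p * q) k = \sum_(j < k.+1) p j * q (k - j)%N.
Proof. by []. Qed.

Lemma ps_coefB p q k : (p - q) k = p k - q k.
Proof. by []. Qed.

Lemma ps_coef_tM m p k : (ps_t K ^+ m * p) k = if (k < m)%N then 0 else p (k - m)%N.
Proof.
elim: m k => [|m IH] k; first by rewrite expr0 mul1r subn0.
rewrite exprS -mulrA ps_coefM; case: k => [|k].
  by rewrite big_ord1 /ps_t mul0r.
rewrite (bigD1 (Ordinal (isT : (1 < k.+2)%N))) //= {1}/ps_t mul1r subSS subn0.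
rewrite big1 ?addr0 => [|i i1]; last first.
  rewrite /ps_t; have [e|_] := eqVneq (i : nat) 1%N; last by rewrite mul0r.
  by case/eqP: i1; apply: val_inj.
by rewrite IH ltnS subSS.
Qed.

Lemma ps_const_is_rmorphism : exists c : {rmorphism K -> powerseries K}, c =1 @ps_const K.
Proof.
apply: mk_rmorphism => [x y|]; first by apply/funext => k; rewrite ps_coefB /ps_const; case: eqP; rewrite ?subr0.
split=> [//|x y]; apply/funext => k; rewrite ps_coefM big_ord_recl /= subn0.
rewrite big1 => [|i _]; last by rewrite /ps_const /= mul0r.
by rewrite addr0 /ps_const /=; case: eqP; rewrite ?mulr0.
Qed.

Lemma ps_coef0_is_rmorphism : exists e : {rmorphism powerseries K -> K}, forall p, e p = p 0%N.
Proof.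
apply: mk_rmorphism => [//|]; split=> [//|p q].
by rewrite ps_coefM big_ord1.
Qed.

(** Each coefficient of the inverse depends on all earlier ones, hence a recursion producing the
    list of the first [k]. *)
Fixpoint ps_inverse_coefs p (k : nat) : seq K :=
  if k is k'.+1 then let s := ps_inverse_coefs p k' in
    rcons s ((p 0%N)^-1 * ((k' == 0%N)%:R - \sum_(j < k') s`_j * p (k' - j)%N))
  else [::].

Lemma ps_unitE p : p 0%N != 0 -> p \is a GRing.unit.
Proof.
move=> p0; pose s := ps_inverse_coefs p; pose r : powerseries K := fun k => (s k.+1)`_k.
have ss k : size (s k) = k by elim: k => //= k IH; rewrite size_rcons IH.
have sr m k : (k < m)%N -> (s m)`_k = r k.
  elim: m => // m IH; rewrite ltnS leq_eqVlt => /orP[/eqP->//|lt].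
  by rewrite -(IH lt) /= nth_rcons ss lt.
suff rp : r * p = 1 by apply/unitrPr; exists r; rewrite mulrC.
apply/funext => k; rewrite ps_coefM big_ord_recr /= subnn {2}/r /= nth_rcons ss ltnn eqxx.
rewrite mulrAC mulVf // mul1r (eq_bigr (fun j : 'I_k => (s k)`_j * p (k - j)%N)).
  by rewrite addrC subrK /GRing.one /= /ps_const; case: eqP.
by move=> j _; rewrite sr.
Qed.

Lemma ps_unit_coef0 p : p \is a GRing.unit -> p 0%N != 0.
Proof.
move=> up; have [e he] := ps_coef0_is_rmorphism.
by rewrite -he -unitfE rmorph_unit.
Qed.

Lemma ps_factor p : p != 0 -> exists m u, u \is a GRing.unit /\ p = ps_t K ^+ m * u.
Proof.
move=> p0; have ex : exists m, p m != 0.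
  apply/not_existsP => h; move/eqP: p0; apply; apply/funext => m.
  by apply/eqP/negPn/negP; exact: h.
case: (ex_minnP ex) => m pm mmin; exists m, (fun k => p (k + m)%N); split.
  exact: ps_unitE.
apply/funext => k; rewrite ps_coef_tM; case: ltnP => [lt|le]; last by rewrite subnK.
by apply/eqP/negPn/negP => /mmin; rewrite leqNgt lt.
Qed.

Lemma ps_chain p q : (exists c, q = c * p) \/ (exists c, p = c * q).
Proof.
have [->|p0] := eqVneq p 0; first by right; exists 0; rewrite mul0r.
have [->|q0] := eqVneq q 0; first by left; exists 0; rewrite mul0r.
have [m [u [uu ep]]] := ps_factor p0; have [l [w [uw eq]]] := ps_factor q0.
have key a b x y : (a <= b)%N -> x \is a GRing.unit ->
    ps_t K ^+ b * y = (ps_t K ^+ (b - a) * (y * x^-1)) * (ps_t K ^+ a * x).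
  move=> ab ux; rewrite mulrACA -exprD subnK // -mulrA mulVr // mulr1.
  by [].
have [ml|lm] := leqP m l; first by left; rewrite ep eq; eexists; exact: key.
by right; rewrite ep eq; eexists; apply: key => //; exact: ltnW.
Qed.

Lemma ps_divisible m l u q : u \is a GRing.unit ->
  ps_t K ^+ m * q = ps_t K ^+ l * u -> (m <= l)%N.
Proof.
move=> /ps_unit_coef0 u0 e; rewrite leqNgt; apply: contraNN u0 => lt.
have := congr1 (fun p : powerseries K => p l) e; rewrite !ps_coef_tM lt ltnn subnn.
by move=> <-.
Qed.

Lemma tval_monomial (R : realType) m u : u \is a GRing.unit ->
  Defs.tval R (fun _ : unit => ps_laurent (ps_t K ^+ m * u)) = m%:R%:E.
Proof.
move=> uu; apply/eqP; rewrite eq_le; apply/andP; split; last first.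
  apply: ereal_sup_ubound; exists (Posz m) => //.
  by exists (fun=> u) => _; rewrite /ps_laurent tofracM tofracXn.
apply: ge_ereal_sup => _ [[l|l] [w /(_ tt) ew] <-]; last first.
  by rewrite lee_fin NegzE mulrNz (le_trans (y := 0)) ?ler0n // oppr_le0 ler0n.
rewrite lee_fin ler_nat; apply: (@ps_divisible l m u (w tt) uu); apply/eqP.
by rewrite -tofrac_eq; apply/eqP; rewrite [LHS]tofracM tofracXn; exact/esym.
Qed.

End PowerSeries.

Lemma prod_monomials (K : fieldType) (I : finType) (m : I -> nat) (w : I -> powerseries K) :
  (forall l, w l \is a GRing.unit) ->
  exists2 u, u \is a GRing.unit & \prod_l (ps_t K ^+ m l * w l) = ps_t K ^+ (\sum_l m l) * u.
Proof.
move=> uw; exists (\prod_l w l); first exact: rpred_prod.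
by rewrite big_split expr_sum.
Qed.

(** The exponents [m] serve twice: their sum is the valuation of the determinant, as needed for the
    numerator of [stable_mu], and they are the weights of a one-parameter subgroup. *)
Lemma ps_smith (K : fieldType) (n : nat) (A : 'M[powerseries K]_n) : \det A != 0 ->
  exists k h (m : 'I_n -> nat) (w : 'I_n -> powerseries K),
    [/\ k \in unitmx, h \in unitmx, is_diag_mx (k *m A *m h),
      forall l, w l \is a GRing.unit /\ (k *m A *m h) l l = ps_t K ^+ m l * w l &
      exists2 u, u \is a GRing.unit & \det A = ps_t K ^+ (\sum_l m l) * u].
Proof.
move=> dA; have [k [h [uk uh dg]]] := chain_diagonal (@ps_chain K) A.
have eD : \det (k *m A *m h) = \prod_l (k *m A *m h) l l.
  by apply: det_trig; exact: is_diag_mx_is_trig.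
have D0 l : (k *m A *m h) l l != 0.
  have : \det (k *m A *m h) != 0.
    rewrite !det_mulmx !mulf_neq0 //; first by apply: contraTneq uk => e; rewrite unitmxE e unitr0.
    by apply: contraTneq uh => e; rewrite unitmxE e unitr0.
  by rewrite eD => /prodf_neq0; apply.
have [m {}/boolp.choice[w hw]] := boolp.choice (fun l => ps_factor (D0 l)).
have [u uu eu] := prod_monomials m (fun l => (hw l).1).
exists k, h, m, w; split=> //; exists (u / (\det k * \det h)).
  by rewrite unitrM uu unitrV unitrM -!unitmxE uk uh.
rewrite mulrA; apply: (canRL (mulrK _)); first by rewrite unitrM -!unitmxE uk uh.
rewrite -eu mulrA [\det A * _]mulrC -!det_mulmx eD; apply: eq_bigr => l _.
exact: (hw l).2.
Qed.

(** * One-parameter subgroups and the stable rank *)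

Section Destabilize.
Variables (R : realType) (K : fieldType) (d : nat) (n : 'I_d -> nat) (alpha : 'I_d -> R).
Hypothesis alpha_gt0 : forall i, 0 < alpha i.
Implicit Types (v : tensor K n) (r : R).

(** A one-parameter subgroup with real exponents [a], diagonal in the basis given by [g]; [cost]
    stands for the weighted valuation of its determinants. *)
Definition destabilized r v := exists (g : forall i, 'M[K]_(n i)) (a : forall i, 'I_(n i) -> R),
  [/\ in_G g, forall i l, 0 <= a i l &
    forall j, tensor_act g v j != 0 -> cost alpha a < r * weight a j].

Lemma cost_ge0 (a : forall i, 'I_(n i) -> R) : (forall i l, 0 <= a i l) -> 0 <= cost alpha a.
Proof.
move=> ha; apply: sumr_ge0 => i _; apply: mulr_ge0; first exact: ltW.
exact: sumr_ge0.
Qed.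

Lemma gt_actE (g : forall i : 'I_d, 'M[powerseries K]_(n i)) v :
  gt_act g v = tensor_map (@ps_laurent K) (tensor_act g (tensor_map (@ps_const K) v)).
Proof.
have := tensor_map_act (@FracField.tofrac (powerseries K)) g (tensor_map (@ps_const K) v).
rewrite /gt_act => ->; congr (tensor_act _ _).
by apply/ffunP => j; rewrite !ffunE.
Qed.

Lemma in_Gt_det (g : forall i : 'I_d, 'M[powerseries K]_(n i)) :
  in_Gt g <-> forall i, \det (g i) != 0.
Proof.
have e i : (to_laurent g i \in unitmx) = (\det (g i) != 0).
  by rewrite unitmxE unitfE /to_laurent det_map_mx tofrac_eq0.
by split=> h i; [rewrite -e|rewrite e].
Qed.

Lemma sum_tval_det (g : forall i : 'I_d, 'M[powerseries K]_(n i))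
    (m : forall i : 'I_d, 'I_(n i) -> nat) :
  (forall i, exists2 u, u \is a GRing.unit & \det (g i) = ps_t K ^+ (\sum_l m i l) * u) ->
  (\sum_(i < d) (alpha i)%:E * Defs.tval R (fun _ : unit => \det (to_laurent g i)))%E =
  (cost alpha (fun i l => (m i l)%:R))%:E.
Proof.
move=> hg; rewrite /cost -sumEFin; apply: eq_bigr => i _.
have [u uu eu] := hg i; rewrite EFinM; congr (_ * _)%E.
by rewrite /to_laurent det_map_mx eu tval_monomial // natr_sum.
Qed.

Lemma div_lt_threshold (c r : R) (y : \bar R) : 0 <= c -> (0 < y)%E ->
  (c%:E / y < r%:E)%E -> 0 < r /\ ((c / r)%:E < y)%E.
Proof.
move=> c0; case: y => [y| |] //= y0.
  move: y0; rewrite lte_fin => y0; rewrite inver gt_eqF // -EFinM lte_fin => lt.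
  have r0 : 0 < r by apply: le_lt_trans lt; rewrite divr_ge0 // ltW.
  split=> //; rewrite lte_fin ltr_pdivrMr // mulrC; by rewrite ltr_pdivrMr in lt.
by rewrite invey mule0 lte_fin => r0; split=> //; rewrite ltry.
Qed.

Lemma div_lt_of_threshold (c r : R) (p : R) (y : \bar R) : 0 <= c -> 0 < p -> (p%:E <= y)%E ->
  0 < r -> c < r * p -> (c%:E / y < r%:E)%E.
Proof.
move=> c0 p0; case: y => [y| |] //=; last by rewrite invey mule0 lte_fin.
rewrite lee_fin => py r0 lt; have y0 : 0 < y by exact: lt_le_trans py.
rewrite inver gt_eqF // -EFinM lte_fin ltr_pdivrMr //; apply: lt_le_trans lt _.
by rewrite ler_pM2l.
Qed.

(* If [g = k^-1 D h^-1] with [D] diagonal, then the one-parameter subgroup [D]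
   applied to the value of [h^-1 v] at [t = 0] is at least as good as [g]. *)
Lemma stable_mu_lt_destabilized r (g : forall i : 'I_d, 'M[powerseries K]_(n i)) v :
  in_Gt g -> (0 < Defs.tval R (gt_act g v))%E -> (stable_mu alpha g v < r%:E)%E ->
  0 < r /\ destabilized r v.
Proof.
move=> /in_Gt_det dg tv0.
have smith i := ps_smith (dg i).
have [k {}/fin_all_exists[h {}/fin_all_exists[m {}/fin_all_exists[w hs]]]] := fin_all_exists smith.
pose a : forall i : 'I_d, 'I_(n i) -> R := fun i l => (m i l)%:R.
have a0 : forall i l, 0 <= a i l by move=> i l; exact: ler0n.
rewrite /stable_mu (@sum_tval_det g m); last by move=> i; case: (hs i).
move=> /(div_lt_threshold (cost_ge0 a0) tv0)[r0 /ereal_sup_gt[_ [z [u hu] <-]]].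
rewrite lte_fin => ltz; split=> //.
(* [z] exceeds the nonnegative threshold, so it is a natural number. *)
have [M eM] : exists M : nat, z = Posz M.
  case: z ltz {hu} => [M _|M]; first by exists M.
  have := divr_ge0 (cost_ge0 a0) (ltW r0) => h1 h2.
  have := le_lt_trans h1 h2; rewrite NegzE mulrNz oppr_gt0.
  by rewrite ltNge ler0n.
rewrite {}eM {z} in ltz hu.
have [e0 he0] := ps_coef0_is_rmorphism K; have [c hc] := ps_const_is_rmorphism K.
pose vc := tensor_map c v.
have eu : tensor_act g vc = [ffun j => ps_t K ^+ M * u j].
  apply/ffunP => j; rewrite [RHS]ffunE; apply/eqP; rewrite -tofrac_eq; apply/eqP.
  rewrite tofracM tofracXn; have := hu j; rewrite gt_actE ffunE => <-.
  congr (FracField.tofrac (tensor_act _ _ j)).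
  by apply/ffunP => l; rewrite !ffunE hc.
have uh i : h i \in unitmx by case: (hs i).
pose b i := invmx (h i).
exists (fun i => map_mx e0 (b i)), a; split=> // [i|j].
  by rewrite unitmxE det_map_mx rmorph_unit // -unitmxE unitmx_inv.
have -> : v = tensor_map e0 vc.
  by apply/ffunP => l; rewrite !ffunE he0 hc.
rewrite -tensor_map_act ffunE he0 => nz.
pose D i := k i *m g i *m h i.
have eD : tensor_act D (tensor_act b vc) j = ps_t K ^+ M * tensor_act k [ffun j => u j] j.
  rewrite -tensor_actM (eq_tensor_act _ (h := fun i => k i *m g i)); last first.
    by move=> i; rewrite /D mulmxK.
  rewrite tensor_actM eu !ffunE big_distrr; apply: eq_bigr => l _ /=.
  by rewrite !ffunE mulrCA.
(* Compare the coefficients of degree [\sum_i m i (j i)] in [eD]: on the left it is a unit's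
   constant term times the nonzero constant term of [b v], on the right it vanishes if this degree
   is below [M]. *)
have Mle : (M <= \sum_(i < d) m i (j i))%N.
  rewrite leqNgt; apply: contraNN nz => lt.
  have [y uy ey] := @prod_monomials K _ (fun i => m i (j i)) (fun i => w i (j i))
    (fun i => let: And5 _ _ _ hw _ := hs i in (hw (j i)).1).
  move: eD; rewrite tensor_act_diag; last by move=> i; case: (hs i).
  have -> : \prod_(i < d) D i (j i) (j i) = ps_t K ^+ (\sum_(i < d) m i (j i)) * y.
    by rewrite -ey; apply: eq_bigr => i _; have [_ _ _ /(_ (j i))[_ ->] _] := hs i.
  move=> eD; have := congr1 (fun p : powerseries K => p (\sum_(i < d) m i (j i))%N) eD.
  rewrite -mulrA !ps_coef_tM ltnn lt subnn -!he0 rmorphM => /eqP.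
  by rewrite mulf_eq0 he0 (negPf (ps_unit_coef0 uy)).
rewrite ltr_pdivrMr // mulrC in ltz; apply: lt_le_trans ltz _.
rewrite ler_pM2l //; apply: (@le_trans _ _ (\sum_(i < d) m i (j i))%N%:R).
  by rewrite ler_nat.
by rewrite natr_sum.
Qed.

End Destabilize.

Section DestabilizedRank.
Variables (R : realType) (K : fieldType) (d : nat) (n : 'I_d -> nat) (alpha : 'I_d -> R).
Hypothesis alpha_gt0 : forall i, 0 < alpha i.
Implicit Types (v : tensor K n) (r : R).

(** Multiply by a large [N] and round down: the cost is at most [N * cost a], and a weight loses at
    most [d]. Hence [r * d < N * gap j] is enough, and the sum [B] takes care of every [j] in the
    support at once. *)
Lemma destabilized_nat r v : 0 < r -> destabilized alpha r v ->
  exists (g : forall i, 'M[K]_(n i)) (m : forall i, 'I_(n i) -> nat), in_G g /\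
    forall j, tensor_act g v j != 0 ->
    cost alpha (fun i l => (m i l)%:R) < r * weight (fun i l => (m i l)%:R) j.
Proof.
move=> r0 [g [a [ug a0 hg]]].
pose gap j := r * weight a j - cost alpha a.
pose B := \sum_(j | tensor_act g v j != 0) (r * d%:R / gap j).
pose N := (Num.truncn B).+1.
have NB : B < N%:R by exact: truncnS_gt.
exists g, (fun i l => Num.truncn (N%:R * a i l)); split=> // j nz.
have Na0 i l : 0 <= N%:R * a i l by rewrite mulr_ge0.
have gap0 k : tensor_act g v k != 0 -> 0 < gap k by move=> /hg; rewrite subr_gt0.
have leB : r * d%:R / gap j <= B.
  rewrite /B (bigD1 j) //= lerDl; apply: sumr_ge0 => k /andP[nzk _].
  by apply: divr_ge0; [apply: mulr_ge0 (ltW r0) (ler0n _ _)|exact/ltW/gap0].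
have h1 : r * d%:R < N%:R * gap j.
  by rewrite -ltr_pdivrMr ?gap0 //; exact: le_lt_trans leB NB.
have h2 : cost alpha (fun i l => (Num.truncn (N%:R * a i l))%:R) <= N%:R * cost alpha a.
  rewrite /cost big_distrr; apply: ler_sum => i _ /=; rewrite mulrCA ler_pM2l //.
  by rewrite big_distrr; apply: ler_sum => l _ /=; rewrite truncn_le.
have h3 : N%:R * weight a j - d%:R <= weight (fun i l => (Num.truncn (N%:R * a i l))%:R : R) j.
  have -> : d%:R = \sum_(i < d) 1 :> R by rewrite sumr_const card_ord.
  rewrite lerBlDr /weight big_distrr /= -big_split.
  apply: ler_sum => i _ /=; apply: ltW; rewrite natr1; exact: truncnS_gt.
apply: le_lt_trans h2 _; apply: (@lt_le_trans _ _ (r * (N%:R * weight a j - d%:R))).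
  move: h1; rewrite /gap; set W := weight a j; set C := cost alpha a; set D := d%:R.
  by rewrite !mulrBr -subr_gt0 -(subr_gt0 (N%:R * C)) (mulrCA r); lra.
by rewrite ler_pM2l.
Qed.

(** The element [t^m g] of [G(K[[t]])] multiplies the coordinate [j] of [g v] by [t^(w j)], so the
    least weight [P] on the support bounds the valuation from below. *)
Lemma destabilized_rank_lt r v : 0 < r -> destabilized alpha r v ->
  (stable_rank alpha v < r%:E)%E.
Proof.
move=> r0 /(destabilized_nat r0)[g [m [ug hg]]].
pose c := cost alpha (fun i l => (m i l)%:R).
have c0 : 0 <= c by apply: cost_ge0 => // i l; exact: ler0n.
pose w (j : mindex n) := (\sum_(i < d) m i (j i))%N.
have [P [P0 cP Pw]] : exists P, [/\ (0 < P)%N, c < r * P%:R &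
    forall j, tensor_act g v j != 0 -> (P <= w j)%N].
  have wE j : weight (fun i l => (m i l)%:R) j = (w j)%:R :> R by rewrite natr_sum.
  have [[j0 nz0]|no] := pselect (exists j, tensor_act g v j != 0); last first.
    (* An empty support imposes no bound, so any positive [P] beyond [c / r] will do. *)
    exists (Num.truncn (c / r)).+1; split=> // [|j nz]; last by case: no; exists j.
    by rewrite mulrC -ltr_pdivrMr // truncnS_gt.
  pose j := [arg min_(j < j0 | tensor_act g v j != 0) w j].
  have [nz mn] : tensor_act g v j != 0 /\
      forall j', tensor_act g v j' != 0 -> (w j <= w j')%N by rewrite /j; case: arg_minnP.
  have lt : c < r * (w j)%:R by rewrite -wE; exact: hg.
  exists (w j); split=> //; rewrite -(ltr_nat R) -(pmulr_rgt0 _ r0).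
  exact: le_lt_trans c0 lt.
have [cst hc] := ps_const_is_rmorphism K.
pose D i : 'M[powerseries K]_(n i) := diag_mx (\row_l ps_t K ^+ m i l).
pose gt i := D i *m map_mx cst (g i).
have det_gt i : exists2 u, u \is a GRing.unit & \det (gt i) = ps_t K ^+ (\sum_l m i l) * u.
  exists (cst (\det (g i))); first by rewrite rmorph_unit // -unitmxE.
  rewrite det_mulmx det_map_mx det_diag; congr (_ * _).
  by rewrite expr_sum; apply: eq_bigr => l _; rewrite mxE.
have Gt : in_Gt gt.
  apply/in_Gt_det => i; have [u uu ->] := det_gt i.
  apply: mulf_neq0; last by apply: contraTneq uu => ->; rewrite unitr0.
  apply: expf_neq0; apply/eqP => /(congr1 (fun p : powerseries K => p 1%N)).
  by move/eqP; rewrite /ps_t oner_eq0.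
have tP : (P%:R%:E <= Defs.tval R (gt_act gt v))%E.
  apply: ereal_sup_ubound; exists (Posz P) => //.
  exists (fun j => ps_t K ^+ (w j - P) * cst (tensor_act g v j)) => j.
  rewrite gt_actE ffunE /ps_laurent -exprnP -tofracXn -tofracM; congr (FracField.tofrac _).
  have -> : tensor_map (@ps_const K) v = tensor_map cst v.
    by apply/ffunP => l; rewrite !ffunE hc.
  rewrite tensor_actM -tensor_map_act tensor_act_diag => [|i]; last exact: diag_mx_is_diag.
  rewrite [tensor_map _ _ _]ffunE mulrA -exprD.
  have -> : \prod_(i < d) D i (j i) (j i) = ps_t K ^+ w j.
    by rewrite expr_sum; apply: eq_bigr => i _; rewrite !mxE eqxx.
  have [->|nz] := eqVneq (tensor_act g v j) 0; first by rewrite rmorph0 !mulr0.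
  by rewrite subnKC // Pw.
have PR0 : 0 < P%:R :> R by rewrite ltr0n.
apply: (@le_lt_trans _ _ (stable_mu alpha gt v)).
  apply: ereal_inf_lbound; exists gt => //; split=> //.
  by apply: lt_le_trans tP; rewrite lte_fin.
rewrite /stable_mu (sum_tval_det _ det_gt).
exact: (div_lt_of_threshold c0 PR0 tP r0 cP).
Qed.

Lemma stable_rank_ge0 v : (0 <= stable_rank alpha v)%E.
Proof.
apply: le_ereal_inf_tmp => _ [g [Gt tv0] <-]; rewrite leNgt; apply/negP => lt.
by have [] := stable_mu_lt_destabilized alpha_gt0 Gt tv0 lt; rewrite ltxx.
Qed.

Lemma stable_rank_ltP r v : 0 < r ->
  (stable_rank alpha v < r%:E)%E <-> destabilized alpha r v.
Proof.
move=> r0; split; last exact: destabilized_rank_lt.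
move=> /ereal_inf_lt[_ [g [Gt tv0] <-]] lt.
by have [] := stable_mu_lt_destabilized alpha_gt0 Gt tv0 lt.
Qed.

End DestabilizedRank.

(** * Strata *)

Section Strata.
Variables (R : realType) (K : fieldType) (d : nat) (n : 'I_d -> nat) (alpha : 'I_d -> R).
Hypothesis alpha_gt0 : forall i, 0 < alpha i.
Implicit Types (v : tensor K n) (r : R) (S : {set mindex n}).

Definition down_closed S := forall j k : mindex n,
  j \in S -> (forall i, k i <= j i)%N -> k \in S.

(** Its kernel is the space of tensors supported in [S], which gives that space as a
    [{vspace _}]. *)
Definition restrict_tensor S (v : tensor K n) : tensor K n :=
  [ffun j => if j \in S then 0 else v j].

Lemma restrict_tensor_is_linear S : linear (restrict_tensor S).
Proof.
move=> c u v; apply/ffunP => j; rewrite !ffunE.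
by case: ifP; rewrite ?scaler0 ?addr0.
Qed.

HB.instance Definition _ S := GRing.isLinear.Build K (tensor K n) (tensor K n) _
  (restrict_tensor S) (restrict_tensor_is_linear S).

Definition coordinate_space S : {vspace tensor K n} := lker (linfun (restrict_tensor S)).

Lemma coordinate_spaceP S v :
  reflect (forall j, v j != 0 -> j \in S) (v \in coordinate_space S).
Proof.
rewrite memv_ker lfunE; apply: (iffP eqP) => [e j|h].
  by move/ffunP: e => /(_ j); rewrite !ffunE; case: ifP => // _ ->; rewrite eqxx.
apply/ffunP => j; rewrite !ffunE; case: ifPn => // nj; apply/eqP.
by apply: contraR nj => /h.
Qed.

Lemma coordinate_space_borel_fixed S : down_closed S -> borel_fixed (coordinate_space S).
Proof.
move=> down b hb z /coordinate_spaceP hz; apply/coordinate_spaceP => j.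
move=> /tensor_act_support[k [zk bk]]; apply: (down k); first exact: hz.
move=> i; have [_ up] := hb i; rewrite leqNgt; apply: contraNN (bk i) => lt.
by rewrite up.
Qed.

(** Only [r] and [S] enter, not the tensor: as there are finitely many [S], this yields both the
    finite union and the passage from [<=] to [<]. Sorting the weights costs a permutation, which
    [G] absorbs. *)
Definition destabilizing r S := exists a : forall i, 'I_(n i) -> R,
  [/\ forall i l, 0 <= a i l, forall i, {homo a i : k l / (k <= l)%N >-> l <= k} &
    forall j, j \in S -> cost alpha a < r * weight a j].

Lemma destabilizing_mono r r' S : r <= r' -> destabilizing r S -> destabilizing r' S.
Proof.
move=> le [a [a0 srt hS]]; exists a; split=> // j /hS lt; apply: lt_le_trans lt _.
by apply: ler_wpM2r => //; apply: sumr_ge0.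
Qed.

Lemma destabilizedP r v : 0 < r -> destabilized alpha r v <->
  exists S, [/\ down_closed S, destabilizing r S & G_translates (coordinate_space S) v].
Proof.
move=> r0; split=> [[g [a [ug a0 hg]]]|[S [_ [a [a0 srt hS]] [g ug [z /coordinate_spaceP hz ->]]]]].
  have [s srt] := fin_all_exists (fun i => sort_weights (a i)).
  pose b := permute s a; pose h i := perm_mx (s i) *m g i.
  have b0 i l : 0 <= b i l by exact: a0.
  have uh : in_G h by move=> i; rewrite unitmx_mul unitmx_perm ug.
  have hh j : tensor_act h v j != 0 -> cost alpha b < r * weight b j.
    rewrite cost_permute tensor_actM => /tensor_act_support[k [/hg lt sk]].
    apply: lt_le_trans lt _; rewrite ler_pM2l //; apply: ler_sum => i _.
    move: (sk i); rewrite !mxE; case: (s i (j i) =P k i) => [<- _|_]; last by rewrite eqxx.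
    by [].
  pose S := [set j : mindex n | cost alpha b < r * weight b j]%SET.
  exists S; split.
  - move=> j k; rewrite !inE => lt le; apply: lt_le_trans lt _; rewrite ler_pM2l //.
    by apply: ler_sum => i _; apply: srt.
  - by exists b; split=> // j; rewrite inE.
  - exists (fun i => invmx (h i)); first by move=> i; rewrite unitmx_inv.
    exists (tensor_act h v); last by rewrite tensor_actK.
    by apply/coordinate_spaceP => j /hh; rewrite inE.
exists (fun i => invmx (g i)), a; split=> // [i|j]; first by rewrite unitmx_inv.
by rewrite tensor_actK // => /hz /hS.
Qed.

Lemma destabilized_gt0 r v : (stable_rank alpha v < r%:E)%E -> 0 < r.
Proof. by move=> lt; rewrite -lte_fin; apply: le_lt_trans (stable_rank_ge0 alpha_gt0 v) lt. Qed.

Lemma stable_rank_lt_finite_union r :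
  finite_union_G_translates [set v : tensor K n | (stable_rank alpha v < r%:E)%E].
Proof.
have [r0|r0] := leP r 0.
  exists [::] => //; apply/seteqP; split=> v /=; last by move=> [Z].
  by move=> /destabilized_gt0; rewrite ltNge r0.
exists [seq coordinate_space U | U <- enum {set mindex n} &
    `[< down_closed U /\ destabilizing r U >]].
  move=> Z /mapP[S]; rewrite mem_filter => /andP[/asboolP[down _] _] ->.
  exact: coordinate_space_borel_fixed.
apply/seteqP; split=> v /=.
  move=> /(stable_rank_ltP alpha_gt0 v r0)/(destabilizedP v r0)[S [down ds vS]].
  exists (coordinate_space S) => //=; apply/mapP; exists S => //.
  by rewrite mem_filter mem_enum andbT; apply/asboolP.
move=> [Z /= /mapP[S]]; rewrite mem_filter => /andP[/asboolP[down ds] _] -> vS.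
by apply/(stable_rank_ltP alpha_gt0 v r0)/(destabilizedP v r0); exists S.
Qed.

(* The weights occurring in [destabilized] only matter through the finitely many
   sets [S]. *)
Lemma stable_rank_le_lt r : exists r',
  [set v : tensor K n | (stable_rank alpha v <= r%:E)%E] =
  [set v : tensor K n | (stable_rank alpha v < r'%:E)%E].
Proof.
have [r0|r0] := ltP r 0.
  exists 0; apply/seteqP; split=> v /= h.
    by apply: le_lt_trans h _; rewrite lte_fin.
  by have := destabilized_gt0 h; rewrite ltxx.
(* [x S] is a value above [r] at which [S] is not destabilizing, if there is one; otherwise [S] is
   destabilizing for every [y > r]. *)
have hS S : exists x, r < x /\ (destabilizing x S -> forall y, r < y -> destabilizing y S).
  have [[x [rx nd]]|all] := pselect (exists x, r < x /\ ~ destabilizing x S).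
    by exists x; split.
  exists (r + 1); split=> [|_ y ry]; first by rewrite ltrDl.
  by apply: contrapT => nd; apply: all; exists y.
have [x hx] := boolp.choice hS.
have [r' [rr' r'x]] : exists r', r < r' /\ forall S, r' <= x S.
  have [S0 _ mn] := @arg_minP _ R {set mindex n} (finset.set0) predT x isT.
  by exists (x S0); split=> [|S]; [exact: (hx S0).1|exact: mn].
have r'0 : 0 < r' by exact: le_lt_trans r0 rr'.
exists r'; apply/seteqP; split=> v /=.
  by move=> le; apply: le_lt_trans le _; rewrite lte_fin.
move=> /(stable_rank_ltP alpha_gt0 v r'0)/(destabilizedP v r'0)[S [down ds vS]].
(* Since [r' <= x S], monotonicity makes [S] destabilizing at [x S], hence at every [y > r]; so the
   rank lies below every such [y]. *)
have dS := (hx S).2 (destabilizing_mono (r'x S) ds).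
have lt y : r < y -> (stable_rank alpha v < y%:E)%E.
  move=> ry; have y0 : 0 < y by exact: le_lt_trans r0 ry.
  by apply/(stable_rank_ltP alpha_gt0 v y0)/(destabilizedP v y0); exists S; split=> //; exact: dS.
rewrite leNgt; apply/negP; case e: (stable_rank alpha v) => [y| |] //.
  by rewrite lte_fin => /lt; rewrite e ltxx.
by move=> _; have := lt (r + 1); rewrite e ltrDl ltr01 => /(_ isT).
Qed.

Lemma destabilizing_feasible r S (L : fieldType) (f : {rmorphism K -> L}) v
    (g : forall i, 'M[L]_(n i)) : 0 < r -> destabilizing r S -> in_G g ->
  (forall j, tensor_act g (tensor_map f v) j != 0 -> j \in S) ->
  exists c, feasible alpha r (tensor_map f v) g c.
Proof.
move=> r0 [a [a0 srt hS]] ug hg; pose gap j := r * weight a j - cost alpha a.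
have gap0 j : j \in S -> 0 < gap j by move/hS; rewrite subr_gt0.
(* A scaling factor with [1 <= l * gap j] for all [j] in [S] simultaneously. *)
pose l := \sum_(j in S) (gap j)^-1.
have l0 : 0 <= l by apply: sumr_ge0 => j /gap0; rewrite invr_ge0; apply: ltW.
exists (fun i m => l * a i m); split=> // [i m|j /hg jS]; first exact: mulr_ge0.
have -> : cost alpha (fun i m => l * a i m) = l * cost alpha a.
  rewrite /cost big_distrr; apply: eq_bigr => i _ /=.
  by rewrite mulrCA [l * \sum_m _]big_distrr.
have -> : weight (fun i m => l * a i m) j = l * weight a j by rewrite /weight big_distrr.
rewrite ler_pdivrMr //; have : 1 <= l * gap j.
  rewrite -ler_pdivrMr ?gap0 // mul1r /l (bigD1 j) //= lerDl.
  by apply: sumr_ge0 => k /andP[/gap0 h _]; rewrite invr_ge0 ltW.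
by rewrite /gap; set W := weight a j; set C := cost alpha a; nra.
Qed.

(** The set is compared with the zeros of all polynomials vanishing on it: such a zero lies in the
    closure of a single stratum, where the place and the descent apply. *)
Lemma stable_rank_lt_closed (hK : perfect_field K) r :
  zariski_closed [set v : tensor K n | (stable_rank alpha v < r%:E)%E].
Proof.
have [r0|r0] := leP r 0.
  (* The rank is nonnegative, so the set is empty and the constant polynomial [1] defines it. *)
  exists [set 1]; apply/seteqP; split=> v /=.
    by move=> /destabilized_gt0; rewrite ltNge r0.
  by move=> /(_ 1 erefl)/eqP; rewrite meval1 oner_eq0.
pose X := [set v : tensor K n | (stable_rank alpha v < r%:E)%E].
exists [set p | forall v, X v -> meval (fun i => v (enum_val i) : K) p = 0].
apply/seteqP; split=> [v Xv p|v /= hv]; first exact.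
apply/(stable_rank_ltP alpha_gt0 v r0).
(* Otherwise each stratum has a polynomial vanishing on it but not at [v]; the product over the
   finitely many strata vanishes on [X] and not at [v]. *)
have [S [down ds hS]] : exists S, [/\ down_closed S, destabilizing r S &
    forall p : mpoly #|mindex n| K, (forall g (z : tensor K n), in_G g -> (forall j, j \notin S -> z j = 0) ->
      meval (fun i => tensor_act g z (enum_val i) : K) p = 0) ->
    meval (fun i => v (enum_val i) : K) p = 0].
  apply: contrapT => no.
  have hp S : exists p : mpoly #|mindex n| K, down_closed S /\ destabilizing r S ->
      (forall g (z : tensor K n), in_G g -> (forall j, j \notin S -> z j = 0) ->
        meval (fun i => tensor_act g z (enum_val i) : K) p = 0) /\
      meval (fun i => v (enum_val i) : K) p != 0.
    have [[down ds]|nds] := pselect (down_closed S /\ destabilizing r S); last by exists 0.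
    apply: contrapT => np; apply: no; exists S; split=> // p h.
    by apply/eqP/negPn/negP => nz; apply: np; exists p.
  have [p {}hp] := boolp.choice hp.
  pose q := \prod_(U | `[< down_closed U /\ destabilizing r U >]) p U.
  suff Xq u : X u -> meval (fun i => u (enum_val i) : K) q = 0.
    have /eqP := hv q Xq; rewrite rmorph_prod; apply/negP/prodf_neq0 => U /asboolP dU.
    exact: (hp U dU).2.
  move=> /(stable_rank_ltP alpha_gt0 u r0)/(destabilizedP u r0)[S [down ds]].
  move=> [g ug [z /coordinate_spaceP hz ->]].
  have dS : down_closed S /\ destabilizing r S by [].
  rewrite rmorph_prod (bigD1 S) /=; last exact/asboolP.
  rewrite (proj1 (hp S dS) g z ug) ?mul0r // => j jS.
  by apply/eqP; apply: contraR jS => /hz.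
have [k [f [g [alg ug hg]]]] := closure_residue_point down hS.
(* It suffices to realize the entries of [g] in [L]: supports are unchanged by the injection [j]
   into [k]. *)
pose T : finType := {i : 'I_d & ('I_(n i) * 'I_(n i))%type}.
pose entry (t : T) := g (tag t) (tagged t).1 (tagged t).2.
have [L [f' [j [tf' jf' him]]]] := tower_embedding (map entry (enum T)) hK alg.
have /boolp.choice[y hy] (t : T) : exists y, j y = entry t.
  by apply: him; apply: map_f; rewrite mem_enum.
pose g' i : 'M[L]_(n i) :=
  \matrix_(a, b) y (Tagged (fun i => ('I_(n i) * 'I_(n i))%type) (a, b)).
have eg i : map_mx j (g' i) = g i by apply/matrixP => a b; rewrite !mxE hy.
have ug' : in_G g' by move=> i; rewrite -(map_unitmx j) eg.
have hg' l : tensor_act g' (tensor_map f' v) l != 0 -> l \in S.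
  move=> nz; apply: hg; rewrite -(eq_tensor_act _ eg).
  have -> : tensor_map f v = tensor_map j (tensor_map f' v).
    by apply/ffunP => m; rewrite !ffunE.
  by rewrite -tensor_map_act ffunE fmorph_eq0.
have [c fc] := destabilizing_feasible r0 ds ug' hg'.
have [|h [a [uh a0 ha]]] := @tower_feasible R d n alpha r K v.
  by exists L, f'; split=> //; exists g', c.
(* The summand [1] in the normalization restores the strict inequality. *)
exists h, a; split=> // l /ha; rewrite ler_pdivrMr // mulrC => le.
by apply: lt_le_trans le; rewrite ltrDr ltr01.
Qed.

End Strata.

Theorem theorem2p11 (R : realType) (K : fieldType) (hK : perfect_field K)
    (d : nat) (n : 'I_d -> nat) (alpha : 'I_d -> R)
    (halpha : forall i, 0 < alpha i) (r : R) :
  let Xo := [set v : tensor K n | (stable_rank alpha v < r%:E)%E] in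
  let X := [set v : tensor K n | (stable_rank alpha v <= r%:E)%E] in
  (finite_union_G_translates Xo /\ finite_union_G_translates X) /\
  (zariski_closed Xo /\ zariski_closed X).
Proof.
move=> Xo X; have [r' eX] : exists r', X = [set v : tensor K n | (stable_rank alpha v < r'%:E)%E].
  exact: stable_rank_le_lt.
rewrite eX; split; split; first [exact: stable_rank_lt_finite_union|exact: stable_rank_lt_closed].
Qed.
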